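(* Let $W$ be a regular Bessel type matrix weight that admits a factorization $W(z)=W_{\mathsf L}(z)W_{\mathsf R}(z)$, where $z^2W_{\mathsf L}'(z)=h^{\mathsf L}(z)W_{\mathsf L}(z)$ and $z^2W_{\mathsf R}'(z)=W_{\mathsf R}(z)h^{\mathsf R}(z)$ with entire matrix functions $h^{\mathsf L},h^{\mathsf R}$. Let $\mathcal B(F)(z)=F'(z)+\frac{F(z)^2}{z^2}$ for a square matrix function $F$. Then, for all $n\in\mathbb N$, $$z^2\big(Y_n^{\mathsf L}\big)''+\big(Y_n^{\mathsf L}\big)'\begin{bmatrix}2h^{\mathsf L}+2zI&0\\0&-2h^{\mathsf R}+2zI\end{bmatrix}+Y_n^{\mathsf L}\begin{bmatrix}\mathcal B(h^{\mathsf L})&0\\0&\mathcal B(-h^{\mathsf R})\end{bmatrix}=\mathcal B(\widetilde M_n^{\mathsf L})\,Y_n^{\mathsf L},$$ $$z^2\big(Y_n^{\mathsf R}\big)''+\begin{bmatrix}2h^{\mathsf R}+2zI&0\\0&-2h^{\mathsf L}+2zI\end{bmatrix}\big(Y_n^{\mathsf R}\big)'+\begin{bmatrix}\mathcal B(h^{\mathsf R})&0\\0&\mathcal B(-h^{\mathsf L})\end{bmatrix}Y_n^{\mathsf R}=Y_n^{\mathsf R}\,\mathcal B(\widetilde M_n^{\mathsf R}).$$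
   Context: $\mathbb N=\{0,1,2,\dots\}$; $N\ge1$ is fixed; $I$ and $0$ denote identity and zero matrices; block matrices have $N\times N$ blocks. Curve: $\gamma$ is a simple loop starting at the origin, encircling the point at infinity once in the positive direction, and then returning to the origin; $(f)_\pm$ are boundary values on $\gamma$ from the two sides determined by its orientation. Bessel type: an $N\times N$ matrix of weights $W=[W^{(j,k)}]$ with support $\gamma$ is of Bessel type if $W^{(j,k)}(z)=\sum_{m\in I_{j,k}}\varphi_m(z)z^{p_m}\log^{q_m}(z)\,e^{-\lambda_m/z}$, $z\in\gamma$, with finite index sets $I_{j,k}$, exponents $p_m$, $\Re(\lambda_m)\ge0$, $q_m\in\mathbb N$, and $\varphi_m$ Hölder continuous, bounded and nonvanishing on $\gamma$, having a holomorphic extension to $\mathbb C$. Regular: the moments $W_n=\int_\gamma z^nW(z)\frac{dz}{2\pi i}$ exist and $\det[W_{j+k}]_{j,k=0,\dots,n}\ne0$ for all $n\in\mathbb N$. Factorization: $W_{\mathsf L},W_{\mathsf R}$ are invertible matrix solutions of the stated differential equations, holomorphic on $\mathbb C\setminus\gamma$, possibly with a branch point at $0$, so that there are constant matrices $\mathsf C^{\mathsf L},\mathsf C^{\mathsf R}$ with $(W_{\mathsf L})_-=(W_{\mathsf L})_+\mathsf C^{\mathsf L}$, $(W_{\mathsf R})_-=\mathsf C^{\mathsf R}(W_{\mathsf R})_+$ on $\gamma$. Biorthogonal polynomials: $P_n^{\mathsf L},P_n^{\mathsf R}$ are the monic $N\times N$ matrix polynomials of degree $n$ with $\int_\gamma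 P_n^{\mathsf L}(z)W(z)z^k\frac{dz}{2\pi i}=\delta_{n,k}C_n^{-1}$ and $\int_\gamma z^kW(z)P_n^{\mathsf R}(z)\frac{dz}{2\pi i}=\delta_{n,k}C_n^{-1}$ for $k\in\{0,\dots,n\}$, with $C_n$ nonsingular. Second kind functions: $Q_n^{\mathsf L}(z)=\int_\gamma\frac{P_n^{\mathsf L}(z')}{z'-z}W(z')\frac{dz'}{2\pi i}$, $Q_n^{\mathsf R}(z)=\int_\gamma W(z')\frac{P_n^{\mathsf R}(z')}{z'-z}\frac{dz'}{2\pi i}$. Conventions: $P_{-1}^{\mathsf L}=P_{-1}^{\mathsf R}=0$, $Q_{-1}^{\mathsf L}=Q_{-1}^{\mathsf R}=-C_{-1}^{-1}$ (so $-C_{-1}Q^{\mathsf L}_{-1}=-Q^{\mathsf R}_{-1}C_{-1}=I$). Put $$Y_n^{\mathsf L}=\begin{bmatrix}P_n^{\mathsf L}&Q_n^{\mathsf L}\\-C_{n-1}P_{n-1}^{\mathsf L}&-C_{n-1}Q_{n-1}^{\mathsf L}\end{bmatrix},\qquad Y_n^{\mathsf R}=\begin{bmatrix}P_n^{\mathsf R}&-P_{n-1}^{\mathsf R}C_{n-1}\\Q_n^{\mathsf R}&-Q_{n-1}^{\mathsf R}C_{n-1}\end{bmatrix},$$ $$Z_n^{\mathsf L}=Y_n^{\mathsf L}\begin{bmatrix}W_{\mathsf L}&0\\0&W_{\mathsf R}^{-1}\end{bmatrix},\qquad Z_n^{\mathsf R}=\begin{bmatrix}W_{\mathsf R}&0\\0&W_{\mathsf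 L}^{-1}\end{bmatrix}Y_n^{\mathsf R}.$$ Structure matrices: $M_n^{\mathsf L}=(Z_n^{\mathsf L})'(Z_n^{\mathsf L})^{-1}$, $M_n^{\mathsf R}=(Z_n^{\mathsf R})^{-1}(Z_n^{\mathsf R})'$, and $\widetilde M_n^{\mathsf L}(z)=z^2M_n^{\mathsf L}(z)$, $\widetilde M_n^{\mathsf R}(z)=z^2M_n^{\mathsf R}(z)$. *)

(* Defs.v *)
From HB Require Import structures.
From mathcomp Require Import all_boot all_order all_algebra.
From mathcomp Require Import complex.
From mathcomp Require Import all_classical all_reals all_analysis.

Set Implicit Arguments.
Unset Strict Implicit.
Unset Printing Implicit Defensive.

Import Order.TTheory GRing.Theory Num.Theory.
Import numFieldNormedType.Exports.

Local Open Scope classical_set_scope.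
Local Open Scope complex_scope.
Local Open Scope ring_scope.

(* R[i] seen through its numFieldType structure, so that it carries the topology
   and the normed module structure which MathComp-Analysis gives to every
   numFieldType: derive1 and derivable over Cx R are complex differentiation. *)
Definition Cx (R : realType) : numFieldType := R[i].

Section ComplexAnalysis.
Variable R : realType.
Local Notation C := (Cx R).

Definition cexp (z : C) : C :=
  (expR (complex.Re z) * cos (complex.Im z))
  +i* (expR (complex.Re z) * sin (complex.Im z)).

Definition cabs (z : C) : R := complex.Re `|z|.

Definition holomorphic_on (V : normedModType C) (U : set C) (F : C -> V) :=
  forall z, U z -> derivable F z 1.

(* Curves are parametrized by [0, 1]. *)
Definition trace (g : R -> C) : set C := g @` `[0, 1].

Definition velocity (g : R -> C) (t : R) : C :=
  derive1 (fun u => complex.Re (g u)) t +i* derive1 (fun u => complex.Im (g u)) t.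

Definition pullback (g : R -> C) (f : C -> C) (t : R) : C :=
  f (g t) * velocity g t.

Definition contour_integrable (g : R -> C) (f : C -> C) : Prop :=
  (@lebesgue_measure R).-integrable `[0, 1]
    (fun t => (complex.Re (pullback g f t))%:E) /\
  (@lebesgue_measure R).-integrable `[0, 1]
    (fun t => (complex.Im (pullback g f t))%:E).

(* The integral of f over g against dz / (2 pi i). *)
Definition contour_int (g : R -> C) (f : C -> C) : C :=
  (Rintegral (@lebesgue_measure R) `[0, 1] (fun t => complex.Re (pullback g f t))
   +i* Rintegral (@lebesgue_measure R) `[0, 1]
         (fun t => complex.Im (pullback g f t)))
  / (0 +i* (2 * pi)).

Definition winding (g : R -> C) (z : C) : C :=
  contour_int g (fun s => (s - z)^-1).

(* Simple loop based at the origin: C^1 off finitely many parameters and of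
   finite length. Encircling infinity once in the positive direction means
   keeping infinity on the left, i.e. winding once clockwise around the points
   enclosed in the plane. *)
Record bessel_loop (g : R -> C) : Prop := BesselLoop {
  loop_start : g 0 = 0;
  loop_end : g 1 = 0;
  loop_continuous : {within `[0, 1], continuous g};
  loop_simple : forall s t, 0 <= s < 1 -> 0 <= t < 1 -> g s = g t -> s = t;
  loop_smooth : exists2 S : set R, finite_set S &
    forall t, 0 < t < 1 -> ~ S t ->
      [/\ derivable (fun u => complex.Re (g u)) t 1,
          derivable (fun u => complex.Im (g u)) t 1 &
          {for t, continuous (velocity g)}];
  loop_rectifiable : contour_integrable g (fun=> 1);
  loop_positive_about_infinity :
    exists2 z, ~ trace g z & winding g z = -1
}.

(* The + side of an oriented curve is its left side. For the loops above it is
   the unbounded component of the complement, the - side the bounded one. *)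
Definition plus_side (g : R -> C) : set C :=
  [set z | ~ trace g z /\ winding g z = 0].
Definition minus_side (g : R -> C) : set C :=
  [set z | ~ trace g z /\ winding g z = -1].

(* The curve without its base point, at which the weights and the factors of
   the weights may be singular. *)
Definition punctured_trace (g : R -> C) : set C := trace g `\ 0.

End ComplexAnalysis.

Section BesselWeights.
Variables (R : realType) (g : R -> Cx R).
Local Notation C := (Cx R).

(* A determination of the logarithm along the (open) arc; it need not extend
   continuously to the base point 0, nor to a neighbourhood of the curve. *)
Definition log_branch (lg : C -> C) : Prop :=
  {within punctured_trace g, continuous lg} /\
  forall z, punctured_trace g z -> cexp (lg z) = z.

Record bessel_amplitude (phi : C -> C) : Prop := BesselAmplitude {
  amplitude_entire : holomorphic_on setT phi;
  amplitude_hoelder : exists (a K : R), 0 < a <= 1 /\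
    forall z w, trace g z -> trace g w ->
      cabs (phi z - phi w) <= K * (cabs (z - w) `^ a);
  amplitude_bounded : exists K : R, forall z, trace g z -> cabs (phi z) <= K;
  amplitude_neq0 : forall z, trace g z -> phi z != 0
}.

Definition bessel_scalar (lg : C -> C) (w : C -> C) : Prop :=
  exists (r : nat) (phi : 'I_r -> C -> C) (p lam : 'I_r -> C) (q : 'I_r -> nat),
    (forall m, bessel_amplitude (phi m) /\ 0 <= complex.Re (lam m)) /\
    forall z, punctured_trace g z ->
      w z = \sum_(m < r)
              phi m z * cexp (p m * lg z) * lg z ^+ q m * cexp (- lam m / z).

Definition bessel_type (N : nat) (W : C -> 'M[C]_N) : Prop :=
  exists2 lg, log_branch lg & forall j k, bessel_scalar lg (fun z => W z j k).

Definition contour_int_mx (m n : nat) (F : C -> 'M[C]_(m, n)) : 'M[C]_(m, n) :=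
  \matrix_(i, j) contour_int g (fun z => F z i j).

Definition moment (N : nat) (W : C -> 'M[C]_N) (n : nat) : 'M[C]_N :=
  contour_int_mx (fun z => z ^+ n *: W z).

Definition regular (N : nat) (W : C -> 'M[C]_N) : Prop :=
  (forall n i j, contour_integrable g (fun z => (z ^+ n *: W z) i j)) /\
  (forall n, \det (\mxblock_(j < n.+1, k < n.+1) moment W (j + k)%N) != 0).

(* F_+ and F_- at the point s of the curve, for side = plus_side g, resp.
   minus_side g. *)
Definition boundary_value (N : nat) (side : set C) (F : C -> 'M[C]_N)
    (s : C) (A : 'M[C]_N) : Prop :=
  F @ within side (nbhs s) --> A.

(* WL and WR are single-valued branches: cut is a closed set off which they are
   holomorphic, and which allows for a branch point at 0; it is empty when WL
   and WR are single-valued on the complement of the curve. The values of WL and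
   WR in W = WL WR on the curve may be read from either side. *)
Record factorization (N : nat) (cut : set C) (W WL WR hL hR : C -> 'M[C]_N) :
    Prop := Factorization {
  cut_closed : closed cut;
  cut_trace : cut `&` trace g `<=` [set 0];
  factorL_holo : holomorphic_on (~` (trace g `|` cut)) WL;
  factorR_holo : holomorphic_on (~` (trace g `|` cut)) WR;
  factorL_unit : forall z, (~` (trace g `|` cut)) z -> WL z \in unitmx;
  factorR_unit : forall z, (~` (trace g `|` cut)) z -> WR z \in unitmx;
  hL_entire : holomorphic_on setT hL;
  hR_entire : holomorphic_on setT hR;
  factorL_ode : forall z, (~` (trace g `|` cut)) z ->
    z ^+ 2 *: derive1 WL z = hL z *m WL z;
  factorR_ode : forall z, (~` (trace g `|` cut)) z ->
    z ^+ 2 *: derive1 WR z = WR z *m hR z;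
  factor_boundary : exists (WLp WLm WRp WRm : C -> 'M[C]_N) (CL CR : 'M[C]_N),
    [/\ forall s, punctured_trace g s ->
          [/\ boundary_value (plus_side g) WL s (WLp s),
              boundary_value (minus_side g) WL s (WLm s),
              boundary_value (plus_side g) WR s (WRp s) &
              boundary_value (minus_side g) WR s (WRm s)],
        forall s, punctured_trace g s ->
          WLm s = WLp s *m CL /\ WRm s = CR *m WRp s &
        (forall s, punctured_trace g s -> W s = WLp s *m WRp s) \/
        (forall s, punctured_trace g s -> W s = WLm s *m WRm s)]
}.

End BesselWeights.

(* Monic matrix polynomials live in {poly 'M_N.+1}: the value at the scalar z is
   the value at the central matrix z%:M. *)
Section Biorthogonality.
Variables (R : realType) (N : nat) (g : R -> Cx R).
Local Notation C := (Cx R).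
Local Notation MC := 'M[C]_N.+1.
Variables (W : C -> MC) (PL PR : nat -> {poly MC}) (Cn : nat -> MC).

Record biorthogonal : Prop := Biorthogonal {
  biorthL_monic : forall n, PL n \is monic /\ size (PL n) = n.+1;
  biorthR_monic : forall n, PR n \is monic /\ size (PR n) = n.+1;
  biorth_unit : forall n, Cn n \in unitmx;
  biorthL : forall n k, (k <= n)%N ->
    contour_int_mx g (fun z => z ^+ k *: ((PL n).[z%:M] *m W z)) =
      if n == k then invmx (Cn n) else 0;
  biorthR : forall n k, (k <= n)%N ->
    contour_int_mx g (fun z => z ^+ k *: (W z *m (PR n).[z%:M])) =
      if n == k then invmx (Cn n) else 0
}.

Definition QL (n : nat) (z : C) : MC :=
  contour_int_mx g (fun s => (s - z)^-1 *: ((PL n).[s%:M] *m W s)).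
Definition QR (n : nat) (z : C) : MC :=
  contour_int_mx g (fun s => (s - z)^-1 *: (W s *m (PR n).[s%:M])).

(* The case n = 0 implements P_{-1} = 0 and - C_{-1} Q_{-1} = I. *)
Definition YL (n : nat) (z : C) : 'M[C]_(N.+1 + N.+1) :=
  match n with
  | 0%N => block_mx (PL 0).[z%:M] (QL 0 z) 0 1%:M
  | m.+1 => block_mx (PL n).[z%:M] (QL n z)
              (- (Cn m *m (PL m).[z%:M])) (- (Cn m *m QL m z))
  end.

Definition YR (n : nat) (z : C) : 'M[C]_(N.+1 + N.+1) :=
  match n with
  | 0%N => block_mx (PR 0).[z%:M] 0 (QR 0 z) 1%:M
  | m.+1 => block_mx (PR n).[z%:M] (- ((PR m).[z%:M] *m Cn m))
              (QR n z) (- (QR m z *m Cn m))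
  end.

Variables WL WR : C -> MC.

Definition ZL (n : nat) (z : C) : 'M[C]_(N.+1 + N.+1) :=
  YL n z *m block_mx (WL z) 0 0 (invmx (WR z)).
Definition ZR (n : nat) (z : C) : 'M[C]_(N.+1 + N.+1) :=
  block_mx (WR z) 0 0 (invmx (WL z)) *m YR n z.

Definition ML (n : nat) (z : C) : 'M[C]_(N.+1 + N.+1) :=
  derive1 (ZL n) z *m invmx (ZL n z).
Definition MR (n : nat) (z : C) : 'M[C]_(N.+1 + N.+1) :=
  invmx (ZR n z) *m derive1 (ZR n) z.

Definition MtL (n : nat) (z : C) : 'M[C]_(N.+1 + N.+1) := z ^+ 2 *: ML n z.
Definition MtR (n : nat) (z : C) : 'M[C]_(N.+1 + N.+1) := z ^+ 2 *: MR n z.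

End Biorthogonality.

Definition calB (R : realType) (m : nat) (F : Cx R -> 'M[Cx R]_m) (z : Cx R) :
    'M[Cx R]_m :=
  derive1 F z + z ^- 2 *: (F z *m F z).

(* Main.v *)
(* Write D for the block diagonal factor of Z = Y D and H for the block diagonal
   matrix with blocks h^L, - h^R. Since D' = z^-2 H D, one gets
   z^2 Z' Z^-1 = (z^2 Y' + Y H) Y^-1, and the left equation follows by
   differentiating (z^2 Z' Z^-1) Y = z^2 Y' + Y H; the right equation is its
   transpose. The Riemann-Hilbert problem is not needed: Y^L is invertible because
   Y^L J Y^R = J with J = [0 I; - I 0], and this identity only uses
   biorthogonality, once p(s) - p(z) is divided by s - z in the kernel 1/(s - z).
   Y^L and Y^R are twice differentiable off the curve by an explicit second order
   expansion of the Cauchy kernel. *)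
Require Import Defs.
From mathcomp Require Import all_boot all_order all_algebra.
From mathcomp Require Import complex ring.
From mathcomp Require Import all_classical all_reals all_analysis.
From mathcomp Require Import measurable_realfun.
Set Implicit Arguments.
Unset Strict Implicit.
Unset Printing Implicit Defensive.
Import Order.TTheory GRing.Theory Num.Theory numFieldNormedType.Exports.
Local Open Scope classical_set_scope.
Local Open Scope complex_scope.
Local Open Scope ring_scope.

(** * Derivatives of matrix-valued functions *)

(** [invmx] and [derive1] are total functions, with conventional values on singular matrices and
    where the limit fails. Writing down M_n^L therefore guarantees nothing: the invertibility of Y
    and D and the existence of derivatives are real obligations, and they are needed on a whole
    neighbourhood of z, because M is itself differentiated. The complement of the curve and the cut
    is open, and it avoids 0 because the loop passes through the origin, so z^-2 is harmless there.
    The identity with J splits into the Casorati combinations P_n^L Q_m^R - Q_n^L P_m^R with n and m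
    equal or consecutive. These do not depend on z: they vanish for equal indices and are an inverse
    C_k^-1, up to sign, for consecutive ones. For smoothness, the weight may be singular at the base
    point and only its integrability is available. All dependence on z is therefore put into a
    kernel that is continuous along the compact curve, and the weight enters the estimates through
    one fixed constant. *)

Section MatrixDerivative.
Variable K : numFieldType.

(** A neighbourhood of a matrix contains a box of neighbourhoods of its entries, and a filter is
    stable under the finite intersection over all index pairs. *)
Lemma cvg_mxP (T : Type) (F : set_system T) (FF : Filter F) m n
    (f : T -> 'M[K]_(m, n)) (A : 'M[K]_(m, n)) :
  f @ F --> A <-> forall i j, (fun t => f t i j) @ F --> A i j.
Proof.
split=> [fA i j P PA|fA P [Q QA QP]].
  apply: (fA (fun B => P (B i j))).
  exists (fun i' j' => if (i' == i) && (j' == j) then P else setT).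
    by move=> i' j'; case: ifP => [/andP[/eqP-> /eqP->]|_] //; exact: filterT.
  by move=> B /(_ i j); rewrite !eqxx.
have : \forall t \near F, forall ij : 'I_m * 'I_n, Q ij.1 ij.2 (f t ij.1 ij.2).
  by apply: filter_forall => -[i j]; apply: fA; exact: QA.
by apply: filterS => t Qt; apply: QP => i j; exact: (Qt (i, j)).
Qed.

Lemma is_deriveP (V : normedModType K) (f : K -> V) (z : K) d :
  is_derive z 1 f d <->
  (fun h => h^-1 *: (f (h + z) - f z)) @ 0^' --> d.
Proof.
have -> : (fun h => h^-1 *: (f (h + z) - f z)) =
          (fun h => h^-1 *: ((f \o shift z) (h *: 1) - f z)).
  by apply/funext => h /=; rewrite [h *: 1]mulr1.
split=> [[/cvg_ex[l fl] <-]|fd].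
  by rewrite /derive (cvg_lim _ fl).
split; first by apply/cvg_ex; exists d.
exact: cvg_lim.
Qed.

Lemma is_derive_derive1 (V : normedModType K) (f : K -> V) (z : K) d :
  is_derive z 1 f d -> derive1 f z = d.
Proof. by move=> [_ <-]; exact: derive1E. Qed.

Lemma derivable_is_derive1 (V : normedModType K) (f : K -> V) (z : K) :
  derivable f z 1 -> is_derive z 1 f (derive1 f z).
Proof. by move=> df; rewrite derive1E; exact/derivableP. Qed.

Lemma is_derive_mxP m n (F : K -> 'M[K]_(m, n)) (z : K) D :
  is_derive z 1 F D <-> forall i j, is_derive z 1 (fun w => F w i j : K) (D i j).
Proof.
have E i j : (fun h => h^-1 *: (F (h + z) i j - F z i j : K)) =
    (fun h => (h^-1 *: (F (h + z) - F z)) i j) by apply/funext => h; rewrite !mxE.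
split=> [/is_deriveP/cvg_mxP FD i j|FD].
  by apply/is_deriveP; rewrite E.
by apply/is_deriveP/cvg_mxP => i j; rewrite -E; apply/is_deriveP.
Qed.

Lemma is_derive_mulmx m n p (F : K -> 'M[K]_(m, n)) (G : K -> 'M[K]_(n, p))
    (z : K) DF DG : is_derive z 1 F DF -> is_derive z 1 G DG ->
  is_derive z 1 (fun w => F w *m G w) (DF *m G z + F z *m DG).
Proof.
move=> /is_derive_mxP dF /is_derive_mxP dG; apply/is_derive_mxP => i j.
have -> : (fun w => (F w *m G w) i j : K) =
    \sum_(k < n) (fun w => F w i k : K) * (fun w => G w k j : K).
  by apply/funext => w; rewrite mxE fct_sumE.
apply: is_derive_eq; rewrite !mxE -big_split /=; apply: eq_bigr => k _.
by rewrite addrC; congr (_ + _); rewrite [LHS]mulrC.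
Qed.

Lemma is_derive_scalemx m n (f : K -> K) (F : K -> 'M[K]_(m, n)) (z : K) df DF :
  is_derive z 1 f df -> is_derive z 1 F DF ->
  is_derive z 1 (fun w => f w *: F w) (df *: F z + f z *: DF).
Proof.
move=> fd /is_derive_mxP dF; apply/is_derive_mxP => i j.
have -> : (fun w => (f w *: F w) i j : K) = f * (fun w => F w i j : K).
  by apply/funext => w; rewrite mxE.
apply: is_derive_eq; rewrite !mxE.
by rewrite addrC; congr (_ + _); rewrite [LHS]mulrC.
Qed.

Lemma is_derive_trmx m n (F : K -> 'M[K]_(m, n)) (z : K) D :
  is_derive z 1 F D -> is_derive z 1 (fun w => (F w)^T) D^T.
Proof.
move=> /is_derive_mxP dF; apply/is_derive_mxP => i j.
by under eq_fun do rewrite mxE; rewrite mxE.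
Qed.

Lemma is_derive_block_mx m1 m2 n1 n2 (A : K -> 'M[K]_(m1, n1))
    (B : K -> 'M[K]_(m1, n2)) (C : K -> 'M[K]_(m2, n1)) (D : K -> 'M[K]_(m2, n2))
    (z : K) dA dB dC dD :
  is_derive z 1 A dA -> is_derive z 1 B dB ->
  is_derive z 1 C dC -> is_derive z 1 D dD ->
  is_derive z 1 (fun w => block_mx (A w) (B w) (C w) (D w))
    (block_mx dA dB dC dD).
Proof.
move=> /is_derive_mxP hA /is_derive_mxP hB /is_derive_mxP hC /is_derive_mxP hD.
apply/is_derive_mxP => i j; rewrite !mxE.
under eq_fun do rewrite !mxE.
by case: (fintype.split i) => i'; under eq_fun do rewrite !mxE;
  rewrite !mxE; case: (fintype.split j) => j'.
Qed.

Lemma derivable_prod (I : Type) (r : seq I) (f : I -> K -> K) (z : K) :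
  (forall i, derivable (f i) z 1) ->
  derivable (fun w => \prod_(i <- r) f i w) z 1.
Proof.
move=> df; elim: r => [|i r IHr].
  by under eq_fun do rewrite big_nil; exact: derivable_cst.
under eq_fun do rewrite big_cons.
exact: derivableM (df i) IHr.
Qed.

Lemma derivable_bigsum (I : Type) (r : seq I) (f : I -> K -> K) (z : K) :
  (forall i, derivable (f i) z 1) ->
  derivable (fun w => \sum_(i <- r) f i w) z 1.
Proof.
move=> df; elim: r => [|i r IHr].
  by under eq_fun do rewrite big_nil; exact: derivable_cst.
under eq_fun do rewrite big_cons.
exact: derivableD (df i) IHr.
Qed.

Lemma derivable_det n (F : K -> 'M[K]_n) (z : K) :
  (forall i j, derivable (fun w => F w i j : K) z 1) ->
  derivable (fun w => \det (F w)) z 1.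
Proof.
move=> dF; apply: derivable_bigsum => s.
apply: derivableM; first exact: derivable_cst.
exact: derivable_prod.
Qed.

(** The cofactor formula shows that the entries are derivable but gives no usable value; the value
    then follows by differentiating the product of [invmx (F w)] and [F w], which is constant.
    Invertibility is asked near [z] because [invmx] obeys the cofactor formula only on invertible
    matrices. *)
Lemma is_derive_invmx n (F : K -> 'M[K]_n) (z : K) D :
  (\forall w \near z, F w \in unitmx) -> is_derive z 1 F D ->
  is_derive z 1 (fun w => invmx (F w)) (- (invmx (F z) *m D *m invmx (F z))).
Proof.
move=> Fu dF.
have dFij i j : derivable (fun w => F w i j : K) z 1.
  by have /is_derive_mxP/(_ i j)[] := dF.
have Fz : F z \in unitmx := nbhs_singleton Fu.
have iF_der i j : derivable (fun w => invmx (F w) i j : K) z 1.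
  apply: (@near_eq_derivable _ _ _
      (fun w => (\det (F w))^-1 * ((-1) ^+ (j + i) * \det (row' j (col' i (F w)))))).
    near=> w; rewrite /invmx ifT; last by near: w.
    by rewrite !mxE.
  apply: derivableM.
    apply: derivableV; last exact: derivable_det.
    by move: Fz; rewrite unitmxE unitfE.
  apply: derivableM; first exact: derivable_cst.
  apply: derivable_det => k l.
  rewrite (_ : (fun w => _) = (fun w => F w (lift j k) (lift i l))) //.
  by apply/funext => w; rewrite !mxE.
pose G := \matrix_(i, j) 'D_1 (fun w => invmx (F w) i j : K) z.
have dG : is_derive z 1 (fun w => invmx (F w)) G.
  by apply/is_derive_mxP => i j; rewrite mxE; exact/derivableP.
suff <- : G = - (invmx (F z) *m D *m invmx (F z)) by [].
have dI := is_derive_mulmx dG dF.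
have d0 : is_derive z 1 (fun w => invmx (F w) *m F w) 0.
  apply: (@near_eq_is_derive _ _ _ (cst 1%:M)).
  by near=> w; rewrite mulVmx //; near: w.
move: (derive_val (is_derive := dI)); rewrite (derive_val (is_derive := d0)).
move=> /esym/eqP; rewrite addr_eq0 => /eqP GF.
by rewrite -mulNmx -GF -mulmxA mulmxV // mulmx1.
Unshelve. all: by end_near. Qed.

(** [derive1n 2] differentiates the total function [derive1 f], which is known to agree with [f1]
    only near [z]; a derivative depends on the germ alone. *)
Lemma derive1n2E (V : normedModType K) (f f1 : K -> V) (z : K) d :
  (\forall w \near z, is_derive (w : K) 1 f (f1 w)) -> is_derive z 1 f1 d ->
  derive1n 2 f z = d.
Proof.
move=> nf df1; apply: is_derive_derive1; apply: near_eq_is_derive df1.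
by apply: filterS nf => w h; rewrite (is_derive_derive1 h).
Qed.

(** Derivability of [M] belongs to the conclusion because the right-hand version obtains its own
    structure matrix as a transpose of this one and has to differentiate it. *)
Lemma structure_matrixL m (Y Y1 D H : K -> 'M[K]_m) (z : K) (Y2 H1 : 'M[K]_m) :
  z != 0 ->
  (\forall w \near z, [/\ Y w \in unitmx, D w \in unitmx,
     is_derive w 1 Y (Y1 w) & is_derive w 1 D (w ^- 2 *: (H w *m D w))]) ->
  is_derive z 1 Y1 Y2 -> is_derive z 1 H H1 ->
  let M w := w ^+ 2 *: (derive1 (fun u => Y u *m D u) w *m invmx (Y w *m D w)) in
  derivable M z 1 /\
  z ^+ 2 *: Y2 + Y1 z *m (2 *: H z + (2 * z)%:M)
    + Y z *m (H1 + z ^- 2 *: (H z *m H z))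
  = (derive1 M z + z ^- 2 *: (M z *m M z)) *m Y z.
Proof.
move=> z0 nearz dY1 dH M.
have [Yz Dz dY dD] := nbhs_singleton nearz.
(* [E] is w^2 (Y D)' D^-1: the factor [D] cancels, leaving M = E Y^-1 near [z]. *)
pose E w := w ^+ 2 *: Y1 w + Y w *m H w.
have ME : \forall w \near z, E w *m invmx (Y w) = M w.
  near=> w; have [Yw Dw dYw dDw] : [/\ Y w \in unitmx, D w \in unitmx,
     is_derive w 1 Y (Y1 w) & is_derive w 1 D (w ^- 2 *: (H w *m D w))].
    by near: w.
  have w0 : w != 0 by near: w; exact: (@cvgr_neq0 _ _ _ _ _ id z).
  have U : Y w *m D w \in unitmx by rewrite unitmx_mul Yw.
  rewrite /M (is_derive_derive1 (is_derive_mulmx dYw dDw)).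
  apply: (can_inj (mulmxK U)); rewrite -!scalemxAl mulmxKV //.
  rewrite -mulmxA mulKmx //.
  by rewrite scalerDr mulmxDl -!scalemxAr scalerA divff ?expf_neq0 // scale1r
    -!scalemxAl mulmxA.
have dw2 : is_derive z 1 (fun w : K => w ^+ 2) (2 * z).
  rewrite (_ : (fun w : K => w ^+ 2) = id * id) //.
  by apply: is_derive_eq; rewrite /= mulr_natl [z *: 1]mulr1.
have dE : is_derive z 1 E _ := is_deriveD (is_derive_scalemx dw2 dY1) (is_derive_mulmx dY dH).
have Yu : \forall w \near z, Y w \in unitmx by apply: filterS nearz => w [].
have dI := is_derive_invmx Yu dY.
have dM := near_eq_is_derive ME (is_derive_mulmx dE dI).
split; first by case: dM.
rewrite (is_derive_derive1 dM) -(nbhs_singleton ME).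
(* This is M^2 Y. Its first term, divided by z^2, cancels the term - E Y^-1 Y' that differentiating
   Y^-1 contributes to M' Y; this cancellation is the reason for the summand F^2 / z^2 in the
   operator B. *)
have IE : E z *m invmx (Y z) *m E z =
    z ^+ 2 *: (E z *m invmx (Y z) *m Y1 z) + E z *m H z.
  by rewrite {2}/E mulmxDr -scalemxAr [X in _ + X]mulmxA mulmxKV.
rewrite [RHS]mulmxDl [X in _ = X + _]mulmxDl mulmxKV // -[X in _ = _ + X]scalemxAl.
rewrite mulmxN mulNmx !mulmxA !mulmxKV // IE.
rewrite scalerDr scalerA mulVf ?expf_neq0 // scale1r.
rewrite addrA subrK /E mulmxDl.
rewrite !mulmxDr -!scalemxAr scalerDr -!scalemxAl scalerA mulVf ?expf_neq0 //.
rewrite scale1r mul_mx_scalar -!mulmxA.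
(* The two copies of Y' H have different origins: one comes from E', the other from z^-2 E H. *)
rewrite -[2 *: (Y1 z *m H z)]/((1 + 1) *: _) scalerDl scale1r.
set a := z ^+ 2 *: Y2; set b := Y1 z *m H z; set c := (2 * z) *: Y1 z.
set d := Y z *m H1; set e := z ^- 2 *: _.
by rewrite !addrA [RHS](ACl (2*3*5*1*4*6)).
Unshelve. all: by end_near. Qed.

Lemma structure_matrixR m (Y Y1 D H : K -> 'M[K]_m) (z : K) (Y2 H1 : 'M[K]_m) :
  z != 0 ->
  (\forall w \near z, [/\ Y w \in unitmx, D w \in unitmx,
     is_derive w 1 Y (Y1 w) & is_derive w 1 D (w ^- 2 *: (D w *m H w))]) ->
  is_derive z 1 Y1 Y2 -> is_derive z 1 H H1 ->
  let M w := w ^+ 2 *: (invmx (D w *m Y w) *m derive1 (fun u => D u *m Y u) w) in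
  z ^+ 2 *: Y2 + (2 *: H z + (2 * z)%:M) *m Y1 z
    + (H1 + z ^- 2 *: (H z *m H z)) *m Y z
  = Y z *m (derive1 M z + z ^- 2 *: (M z *m M z)).
Proof.
move=> z0 nearz dY1 dH M; apply: trmx_inj.
pose T (F : K -> 'M[K]_m) w := (F w)^T.
have nearT : \forall w \near z, [/\ T Y w \in unitmx, T D w \in unitmx,
     is_derive w 1 (T Y) (T Y1 w) & is_derive w 1 (T D) (w ^- 2 *: (T H w *m T D w))].
  apply: filterS nearz => w [Yw Dw dYw dDw]; split; rewrite ?unitmx_tr //.
    exact: is_derive_trmx.
  by rewrite -trmx_mul -linearZ; exact: is_derive_trmx.
pose N w := w ^+ 2 *:
  (derive1 (fun u => T Y u *m T D u) w *m invmx (T Y w *m T D w)).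
have [dN eqN] : derivable N z 1 /\
    z ^+ 2 *: Y2^T + T Y1 z *m (2 *: T H z + (2 * z)%:M)
      + T Y z *m (H1^T + z ^- 2 *: (T H z *m T H z))
    = (derive1 N z + z ^- 2 *: (N z *m N z)) *m T Y z.
  exact: structure_matrixL z0 nearT (is_derive_trmx dY1) (is_derive_trmx dH).
(* Transposition passes through [derive1] at points where the derivative exists, so the two
   structure matrices are compared only near [z]. *)
have NM : \forall w \near z, (N w)^T = M w.
  apply: filterS nearz => w [Yw Dw dYw dDw].
  rewrite /N /M linearZ /= trmx_mul trmx_inv trmx_mul !trmxK.
  rewrite (_ : (fun u => T Y u *m T D u) = T (fun u => D u *m Y u)); last first.
    by apply/funext => u; rewrite /T trmx_mul.
  have dDY := is_derive_mulmx dDw dYw.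
  by rewrite (is_derive_derive1 (is_derive_trmx dDY)) (is_derive_derive1 dDY) trmxK.
have dM := near_eq_is_derive NM (is_derive_trmx (derivable_is_derive1 dN)).
rewrite (is_derive_derive1 dM) -(nbhs_singleton NM).
rewrite [RHS]trmx_mul [X in _ = X *m _]linearD [X in _ = (_ + X) *m _]linearZ /=.
rewrite [X in _ = (_ + _ *: X) *m _]trmx_mul !trmxK -eqN.
rewrite [LHS]linearD [X in X + _ = _]linearD /= [X in X + _ + _ = _]linearZ /= !trmx_mul.
by rewrite !linearD !linearZ /= trmx_mul tr_scalar_mx.
Qed.
End MatrixDerivative.

(** * Contour integrals *)

Section ComplexParts.
Variable R : realType.
Local Notation C := (Cx R).
Implicit Types x y : C.

Lemma Re_mul x y : complex.Re (x * y) =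
  complex.Re x * complex.Re y - complex.Im x * complex.Im y.
Proof. by case: x; case: y. Qed.

Lemma Im_mul x y : complex.Im (x * y) =
  complex.Re x * complex.Im y + complex.Im x * complex.Re y.
Proof. by case: x => a b; case: y. Qed.

Lemma Re_add x y : complex.Re (x + y) = complex.Re x + complex.Re y.
Proof. by case: x; case: y. Qed.

Lemma Im_add x y : complex.Im (x + y) = complex.Im x + complex.Im y.
Proof. by case: x; case: y. Qed.

Lemma complex_add (a b c d : R) :
  (a +i* b : C) + (c +i* d) = (a + c) +i* (b + d).
Proof. by []. Qed.

Lemma complex_mul (a b c d : R) :
  (a +i* b : C) * (c +i* d) = (a * c - b * d) +i* (a * d + b * c).
Proof. by []. Qed.

Lemma leCR (a b : R) : ((a%:C : C) <= b%:C) = (a <= b).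
Proof. exact: lecR. Qed.

Lemma ltCR (a b : R) : ((a%:C : C) < b%:C) = (a < b).
Proof. exact: ltcR. Qed.

Lemma norm_Re_le x : (`|complex.Re x|)%:C <= `|x|.
Proof. exact: normc_ge_Re. Qed.

Lemma norm_Im_le x : (`|complex.Im x|)%:C <= `|x|.
Proof.
have := normc_ge_Re (x * 'i%C); rewrite ReiNIm normrN normrM => /le_trans; apply.
rewrite [X in _ * X](_ : _ = 1) ?mulr1 //.
by rewrite normc_def /= expr0n /= expr1n add0r sqrtr1.
Qed.

Lemma norm_le_ReIm x : `|x| <= (`|complex.Re x| + `|complex.Im x|)%:C.
Proof.
case: x => a b /=.
rewrite [`|_|]normc_def /= leCR -[leRHS]ger0_norm ?addr_ge0 // -sqrtr_sqr.
rewrite ler_sqrt ?sqr_ge0 // sqrrD !real_normK ?num_real // addrAC lerDl.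
by rewrite mulrn_wge0 // mulr_ge0.
Qed.

Lemma continuous_Re : continuous (@complex.Re R : C -> R).
Proof.
move=> z; apply/(@cvgrPdist_lt _ _ _ _ (nbhs_filter z)) => e e0.
have e0C : (0 : C) < e%:C by rewrite -[0]/(0%:C) ltCR.
have zz : id w @[w --> z] --> z by exact: cvg_id.
have zwe := cvgr_dist_lt _ _ zz _ e0C.
near=> w; rewrite -ltCR; apply: (@le_lt_trans _ _ `|z - w|); last by near: w; exact: zwe.
by rewrite (_ : complex.Re z - complex.Re w = complex.Re (z - w)) ?norm_Re_le //;
  case: (z); case: (w).
Unshelve. all: by end_near. Qed.

Lemma continuous_Im : continuous (@complex.Im R : C -> R).
Proof.
move=> z; apply/(@cvgrPdist_lt _ _ _ _ (nbhs_filter z)) => e e0.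
have e0C : (0 : C) < e%:C by rewrite -[0]/(0%:C) ltCR.
have zz : id w @[w --> z] --> z by exact: cvg_id.
have zwe := cvgr_dist_lt _ _ zz _ e0C.
near=> w; rewrite -ltCR; apply: (@le_lt_trans _ _ `|z - w|); last by near: w; exact: zwe.
by rewrite (_ : complex.Im z - complex.Im w = complex.Im (z - w)) ?norm_Im_le //;
  case: (z); case: (w).
Unshelve. all: by end_near. Qed.

End ComplexParts.

Section ContourIntegral.
Variables (R : realType) (g : R -> Cx R).
Local Notation C := (Cx R).
Local Notation mu := (@lebesgue_measure R).
Local Notation D := (`[0, 1]%classic : set R).
Implicit Types f phi : C -> C.

(* lebesgue_measure lives on measurableTypeR R, not on the default measurable
   structure of R. *)
Let mD : measurable (D : set (measurableTypeR R)). Proof. exact: measurable_itv. Qed.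

Lemma trace_mem t : D t -> trace g (g t). Proof. by exists t. Qed.

(** On the compact interval a continuous factor is measurable and bounded. This is what makes every
    kernel integrable against the weight. *)
Lemma integrable_continuousM (a u : R -> R) :
  {within D, continuous a} -> mu.-integrable D (fun t => (u t)%:E) ->
  mu.-integrable D (fun t => (a t * u t)%:E).
Proof.
move=> ca iu; suff : mu.-integrable D ((EFin \o a) \* (fun t => (u t)%:E))%E.
  by apply: eq_integrable => // t _ /=; rewrite EFinM.
apply: integrableMr iu => //.
  exact: subspace_continuous_measurable_fun.
have /compact_bounded[M [Mr Ma]] := continuous_compact ca (@segment_compact R 0 1).
by exists M; split=> // x Mx t Dt; apply: Ma => //; exists t.
Qed.

Lemma eq_contour_integrable f f' : (forall s, trace g s -> f s = f' s) ->
  contour_integrable g f -> contour_integrable g f'.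
Proof.
move=> ff' [iR iI]; split.
  apply: eq_integrable iR => // t; rewrite inE => Dt.
  by rewrite /pullback ff' //; exact: trace_mem.
apply: eq_integrable iI => // t; rewrite inE => Dt.
by rewrite /pullback ff' //; exact: trace_mem.
Qed.

Lemma eq_contour_int f f' : (forall s, trace g s -> f s = f' s) ->
  contour_int g f = contour_int g f'.
Proof.
move=> ff'; rewrite /contour_int; congr (_ / _).
by congr (_ +i* _); apply: eq_Rintegral => t; rewrite inE => Dt;
  rewrite /pullback ff' //; exact: trace_mem.
Qed.

Lemma contour_integrableD f f' : contour_integrable g f ->
  contour_integrable g f' -> contour_integrable g (fun s => f s + f' s).
Proof.
move=> [iR iI] [iR' iI']; split.
  have := integrableD mD iR iR'; apply: eq_integrable => // t _ /=.
  by rewrite /pullback mulrDl Re_add.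
have := integrableD mD iI iI'; apply: eq_integrable => // t _ /=.
by rewrite /pullback mulrDl Im_add.
Qed.

Lemma contour_intD f f' : contour_integrable g f -> contour_integrable g f' ->
  contour_int g (fun s => f s + f' s) = contour_int g f + contour_int g f'.
Proof.
move=> [iR iI] [iR' iI']; rewrite /contour_int -mulrDl; congr (_ / _).
rewrite complex_add -!RintegralD //.
by congr (_ +i* _); apply: eq_Rintegral => t _;
  rewrite /pullback mulrDl ?Re_add ?Im_add.
Qed.

Lemma pullbackM phi f t :
  pullback g (fun s => phi s * f s) t = phi (g t) * pullback g f t.
Proof. by rewrite /pullback mulrA. Qed.

(** Continuity is asked after composition with [g], on the parameter interval, because that is all
    the integral sees. *)
Definition continuous_along phi := {within D, continuous (phi \o g)}.

Lemma contour_integrableM phi f : continuous_along phi ->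
  contour_integrable g f -> contour_integrable g (fun s => phi s * f s).
Proof.
move=> cphi [iR iI].
have cR : {within D, continuous (fun t => complex.Re (phi (g t)))}.
  by move=> t; apply: (continuous_comp (cphi t)); exact: continuous_Re.
have cI : {within D, continuous (fun t => complex.Im (phi (g t)))}.
  by move=> t; apply: (continuous_comp (cphi t)); exact: continuous_Im.
split.
  apply: eq_integrable (integrableB mD (integrable_continuousM cR iR)
    (integrable_continuousM cI iI)) => // t _.
  by rewrite pullbackM Re_mul.
apply: eq_integrable (integrableD mD (integrable_continuousM cR iI)
  (integrable_continuousM cI iR)) => // t _.
by rewrite pullbackM Im_mul.
Qed.

Lemma continuous_along_cst (c : C) : continuous_along (fun=> c).
Proof. by move=> t; exact: cvg_cst. Qed.

Lemma contour_integrableZ (c : C) f :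
  contour_integrable g f -> contour_integrable g (fun s => c * f s).
Proof. exact: (contour_integrableM (@continuous_along_cst c)). Qed.

Lemma contour_intZ (c : C) f : contour_integrable g f ->
  contour_int g (fun s => c * f s) = c * contour_int g f.
Proof.
move=> [iR iI]; rewrite /contour_int mulrA; congr (_ / _).
have cR (k : R) u : mu.-integrable D (fun t => (u t)%:E) ->
    mu.-integrable D (fun t => (k * u t)%:E).
  by apply: integrable_continuousM => t; exact: cvg_cst.
case: c => a b; rewrite complex_mul -!RintegralZl //.
rewrite -RintegralB ?cR // -RintegralD ?cR //.
congr (_ +i* _); apply: eq_Rintegral => t _; rewrite pullbackM.
  by rewrite Re_mul.
by rewrite Im_mul.
Qed.

(** The constant depends on [f] alone, so it serves a whole family of kernels at once; this
    uniformity takes the place of dominated convergence. *)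
Lemma contour_int_bound f : contour_integrable g f -> exists M : C, 0 <= M /\
  forall phi (B : R), continuous_along phi ->
    (forall s, trace g s -> `|phi s| <= B%:C) ->
    `|contour_int g (fun s => phi s * f s)| <= B%:C * M.
Proof.
move=> if_.
have [iR iI] := if_.
pose I := Rintegral mu D (fun t => `|complex.Re (pullback g f t)|
                                   + `|complex.Im (pullback g f t)|).
have I0 : 0 <= I by apply: Rintegral_ge0 => t _; rewrite addr_ge0.
have iN : mu.-integrable D (fun t => (`|complex.Re (pullback g f t)|
                                   + `|complex.Im (pullback g f t)|)%:E).
  by apply: eq_integrable (integrableD mD (integrable_norm iR) (integrable_norm iI)).
(* Twice [I], because the real and the imaginary part of the integral are each bounded by
   [B * I]. *)
exists ((I + I)%:C * `|(0 +i* (2 * pi) : C)^-1|); split.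
  by rewrite mulr_ge0 // -[0]/(0%:C) leCR addr_ge0.
move=> phi B cphi phiB; have [jR jI] := contour_integrableM cphi if_.
rewrite /contour_int normrM mulrA ler_wpM2r //.
apply: le_trans (norm_le_ReIm _) _.
rewrite -rmorphM leCR /= mulrDr -RintegralZl //.
have bound u : mu.-integrable D (fun t => (u t)%:E) ->
    (forall t, D t -> `|u t| <= B * (`|complex.Re (pullback g f t)|
                                   + `|complex.Im (pullback g f t)|)) ->
    `|Rintegral mu D u| <= Rintegral mu D (fun t =>
       B * (`|complex.Re (pullback g f t)| + `|complex.Im (pullback g f t)|)).
  move=> iu ub; apply: le_trans (le_normr_Rintegral mD iu) _.
  apply: le_Rintegral => //; first exact: integrable_norm.
  by apply: integrable_continuousM => // t; exact: cvg_cst.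
have BR t : D t -> `|complex.Re (phi (g t))| <= B.
  by move=> Dt; rewrite -leCR (le_trans (norm_Re_le _)) // phiB //; exact: trace_mem.
have BI t : D t -> `|complex.Im (phi (g t))| <= B.
  by move=> Dt; rewrite -leCR (le_trans (norm_Im_le _)) // phiB //; exact: trace_mem.
apply: lerD; apply: bound => // t Dt; rewrite pullbackM.
  rewrite Re_mul (le_trans (ler_normB _ _)) // !normrM mulrDr.
  by rewrite lerD // ler_wpM2r // ?BR ?BI.
rewrite Im_mul (le_trans (ler_normD _ _)) // !normrM mulrDr addrC.
by rewrite lerD // ler_wpM2r // ?BR ?BI.
Qed.

End ContourIntegral.

(** * Cauchy transforms and their first two derivatives *)

Section CauchyTransform.
Variables (R : realType) (g : R -> Cx R).
Local Notation C := (Cx R).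
Hypothesis cg : {within `[0, 1], continuous g}.
Implicit Types f phi psi : C -> C.

Lemma trace_closed : closed (trace g).
Proof.
apply: compact_closed; first exact: norm_hausdorff.
by apply: continuous_compact => //; exact: segment_compact.
Qed.

Lemma trace_dist (z : C) : ~ trace g z ->
  exists2 d : R, 0 < d & forall s, trace g s -> d%:C <= `|s - z|.
Proof.
move=> Tz.
have /nbhs_ballP[e /= e0 eT] : nbhs z (~` trace g).
  by apply: open_nbhs_nbhs; split => //; exact/closed_openC/trace_closed.
(* Radii of balls live in the complex field; a positive element there is real. *)
have eE : e = (complex.Re e)%:C by rewrite RRe_real // gtr0_real.
exists (complex.Re e); first by rewrite -ltCR -eE.
move=> s Ts; rewrite -eE real_leNgt ?normr_real ?(gtr0_real e0) //.
apply/negP => sz; apply: (eT s) => //.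
by rewrite -ball_normE /= distrC.
Qed.

Lemma continuous_alongP phi :
  (forall s, trace g s -> {for s, continuous phi}) -> continuous_along g phi.
Proof.
move=> cphi; apply/subspace_continuousP => t Dt.
have /subspace_continuousP ct := cg.
exact: (cvg_comp _ _ (ct t Dt) (cphi (g t) (trace_mem g Dt))).
Qed.

(** With an exact second order expansion, the difference quotient differs from the integral of
    [psi s * f s] by h times the integral of [rho h s * f s], which stays bounded as h tends to
    0. *)
Lemma is_derive_contour_int f (phi rho : C -> C -> C) psi (z : C) (B : R) :
  contour_integrable g f -> 0 <= B ->
  (\forall h \near (0 : C), [/\ continuous_along g (rho h),
     forall s, trace g s -> `|rho h s| <= B%:C &
     forall s, trace g s ->
       phi (h + z) s = phi z s + h * psi s + h ^+ 2 * rho h s]) ->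
  continuous_along g (phi z) -> continuous_along g psi ->
  is_derive z 1 (fun w => contour_int g (fun s => phi w s * f s) : C)
    (contour_int g (fun s => psi s * f s)).
Proof.
move=> if_ B0 nearh cphi cpsi.
have [M [M0 boundM]] := contour_int_bound if_.
apply/is_deriveP/(@cvgrPdist_le _ _ _ _ (dnbhs_filter (0 : C))) => e e0.
(* The summand 1 keeps the divisor positive when [B] or [M] is zero. *)
have BM : 0 < B%:C * M + 1 :> C.
  by rewrite ltr_wpDl // mulr_ge0 // -[0]/(0%:C) leCR.
have nearh' := nbhs_dnbhs nearh.
have small := @dnbhs0_lt _ C _ (divr_gt0 e0 BM).
near=> h.
have h0 : h != 0 by near: h; exact: nbhs_dnbhs_neq.
have [crho rhoB phiE] : [/\ continuous_along g (rho h),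
     forall s, trace g s -> `|rho h s| <= B%:C &
     forall s, trace g s ->
       phi (h + z) s = phi z s + h * psi s + h ^+ 2 * rho h s].
  by near: h; exact: nearh'.
have iphi := contour_integrableM cphi if_.
have ipsi := contour_integrableM cpsi if_.
have irho := contour_integrableM crho if_.
have -> : contour_int g (fun s => phi (h + z) s * f s) =
    contour_int g (fun s => phi z s * f s)
    + h * contour_int g (fun s => psi s * f s)
    + h ^+ 2 * contour_int g (fun s => rho h s * f s).
  rewrite -!contour_intZ // -!contour_intD //; last exact: contour_integrableZ.
  - apply: eq_contour_int => s Ts; rewrite phiE //; ring.
  - by apply: contour_integrableD => //; exact: contour_integrableZ.
  - exact: contour_integrableZ.
set J := contour_int g _; set I := contour_int g _; set L := contour_int g _.
rewrite (_ : J - _ = - (h * L)); last by rewrite /GRing.scale /=; field.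
rewrite normrN normrM; apply: le_trans (ler_wpM2l _ (boundM _ _ crho rhoB)) _ => //.
have : `|h| <= e / (B%:C * M + 1) by apply: ltW; near: h; exact: small.
rewrite ler_pdivlMr // => he; apply: le_trans he.
by rewrite ler_wpM2l // lerDl.
Unshelve. all: by end_near. Qed.

(** If every point of the curve is at distance at least d from [z], then for |h| < d/2 it is at
    distance at least d/2 from [h + z]; hence c = 2/d, uniformly in [h] and [s]. *)
Lemma near_trace_inv_bound (z : C) : ~ trace g z -> exists2 c : R, 0 <= c &
  \forall h \near (0 : C), forall s, trace g s ->
    [/\ s - z != 0, s - (h + z) != 0,
        `|(s - z)^-1| <= c%:C & `|(s - (h + z))^-1| <= c%:C].
Proof.
move=> /trace_dist[d d0 dT]; exists (d / 2)^-1.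
  by rewrite invr_ge0 divr_ge0 // ltW.
have d20 : 0 < (d / 2)%:C :> C by rewrite -[0]/(0%:C) ltCR divr_gt0.
have inv_le (x : C) : (d / 2)%:C <= `|x| -> x != 0 /\ `|x^-1| <= ((d / 2)^-1)%:C.
  move=> dx; have x0 : 0 < `|x| by exact: lt_le_trans dx.
  by rewrite -normr_gt0 x0 normfV fmorphV lef_pV2.
have small := @nbhs0_lt _ C _ d20.
near=> h => s Ts.
have hd : `|h| < (d / 2)%:C by near: h; exact: small.
have [a0 aB] : s - z != 0 /\ `|(s - z)^-1| <= ((d / 2)^-1)%:C.
  apply: inv_le; apply: le_trans (dT s Ts).
  by rewrite leCR ler_pdivrMr // ler_peMr ?ltW // ltr1n.
have [b0 bB] : s - (h + z) != 0 /\ `|(s - (h + z))^-1| <= ((d / 2)^-1)%:C.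
  apply: inv_le; rewrite -(lerD2r `|h|).
  have dd : (d / 2)%:C + `|h| <= d%:C.
    by rewrite [X in _ <= X%:C]splitr rmorphD /= lerD2l ltW.
  apply: le_trans dd _; apply: le_trans (dT s Ts) _.
  by apply: le_trans (ler_normD _ _); rewrite opprD addrA addrAC subrK.
by [].
Unshelve. all: by end_near. Qed.

Lemma continuous_along_inv (z : C) : ~ trace g z ->
  continuous_along g (fun s => (s - z)^-1).
Proof.
move=> Tz; apply: continuous_alongP => s Ts.
have sz : s - z != 0 by rewrite subr_eq0; apply: contra_notN Tz => /eqP <-.
have cB : w - z @[w --> s] --> s - z.
  by apply: (@cvgB _ _ _ _ (nbhs_filter s)); [exact: cvg_id|exact: cvg_cst].
exact: cvgV sz cB.
Qed.

Lemma continuous_alongM phi psi : continuous_along g phi ->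
  continuous_along g psi -> continuous_along g (fun s => phi s * psi s).
Proof. by move=> cphi cpsi t; apply: cvgM; [exact: cphi|exact: cpsi]. Qed.

Lemma continuous_alongD phi psi : continuous_along g phi ->
  continuous_along g psi -> continuous_along g (fun s => phi s + psi s).
Proof. by move=> cphi cpsi t; apply: cvgD; [exact: cphi|exact: cpsi]. Qed.

Lemma continuous_alongX k phi :
  continuous_along g phi -> continuous_along g (fun s => phi s ^+ k).
Proof.
move=> cphi; elim: k => [|k IHk]; first exact: continuous_along_cst.
rewrite (_ : (fun s => _) = (fun s => phi s * phi s ^+ k)).
  exact: continuous_alongM.
by apply/funext => s; rewrite exprS.
Qed.

Lemma near_off_trace (z : C) : ~ trace g z -> \forall h \near (0 : C), ~ trace g (h + z).
Proof.
move=> /near_trace_inv_bound[c _]; apply: filterS => h hT Tz.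
by have [_] := hT _ Tz; rewrite subrr eqxx.
Qed.

Definition cauchy_kernel (k : nat) (w s : C) : C := (s - w)^-1 ^+ k.

Lemma continuous_along_cauchy_kernel k (z : C) : ~ trace g z ->
  continuous_along g (cauchy_kernel k z).
Proof. by move=> /continuous_along_inv; exact: continuous_alongX. Qed.

Definition cauchy_int (k : nat) f (w : C) : C :=
  contour_int g (fun s => cauchy_kernel k w s * f s).

(** With a = s - z and b = a - h, exactly 1/b = 1/a + h/a^2 + h^2/(a^2 b). Bounding each inverse by
    c gives c^3. *)
Let remainder1 (z h s : C) : C := (s - z)^-1 ^+ 2 * (s - (h + z))^-1.

Lemma is_derive_cauchy1 f (z : C) : contour_integrable g f -> ~ trace g z ->
  is_derive z 1 (cauchy_int 1 f) (cauchy_int 2 f z).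
Proof.
move=> if_ Tz; have [c c0 nearc] := near_trace_inv_bound Tz.
have nT := near_off_trace Tz.
have cz := continuous_along_inv Tz.
apply: (@is_derive_contour_int f (cauchy_kernel 1) (remainder1 z)
  (cauchy_kernel 2 z) z (c ^+ 2 * c) if_).
- by rewrite mulr_ge0 ?exprn_ge0.
- near=> h.
  have ch : continuous_along g (fun s => (s - (h + z))^-1).
    by apply: continuous_along_inv; near: h; exact: nT.
  have hT : forall s, trace g s -> [/\ s - z != 0, s - (h + z) != 0,
      `|(s - z)^-1| <= c%:C & `|(s - (h + z))^-1| <= c%:C] by near: h.
  split.
  + exact: (continuous_alongM (continuous_alongX (k := 2%N) cz) ch).
  + move=> s Ts; have [_ _ aB bB] := hT s Ts.
    rewrite normrM normrX rmorphM rmorphXn /=.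
    by rewrite ler_pM ?exprn_ge0 // lerXn2r // nnegrE -[0]/(0%:C) leCR.
  + move=> s Ts; have [a0 b0 _ _] := hT s Ts.
    by rewrite /cauchy_kernel /remainder1; field; rewrite a0 b0.
- exact: continuous_along_cauchy_kernel.
- exact: continuous_along_cauchy_kernel.
Unshelve. all: by end_near. Qed.

(** In the same notation, 1/b^2 = 1/a^2 + 2h/a^3 + h^2 (a + 2b)/(a^3 b^2); the last fraction is
    written as a product of inverses so that each can be bounded by c. *)
Let remainder2 (z h s : C) : C :=
  (s - z)^-1 ^+ 2 * (s - (h + z))^-1 * (2 * (s - z)^-1 + (s - (h + z))^-1).

Let kernel3 (z s : C) : C := 2 * cauchy_kernel 3 z s.

Lemma is_derive_cauchy2 f (z : C) : contour_integrable g f -> ~ trace g z ->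
  is_derive z 1 (cauchy_int 2 f) (contour_int g (fun s => kernel3 z s * f s)).
Proof.
move=> if_ Tz; have [c c0 nearc] := near_trace_inv_bound Tz.
have nT := near_off_trace Tz.
have cz := continuous_along_inv Tz.
apply: (@is_derive_contour_int f (cauchy_kernel 2) (remainder2 z)
  (kernel3 z) z (c ^+ 2 * c * (2 * c + c)) if_).
- by rewrite mulr_ge0 ?addr_ge0 ?mulr_ge0 ?exprn_ge0.
- near=> h.
  have ch : continuous_along g (fun s => (s - (h + z))^-1).
    by apply: continuous_along_inv; near: h; exact: nT.
  have hT : forall s, trace g s -> [/\ s - z != 0, s - (h + z) != 0,
      `|(s - z)^-1| <= c%:C & `|(s - (h + z))^-1| <= c%:C] by near: h.
  split.
  + have c2 := continuous_alongM (@continuous_along_cst _ g 2) cz.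
    have cz2 := continuous_alongX (k := 2%N) cz.
    exact: (continuous_alongM (continuous_alongM cz2 ch) (continuous_alongD c2 ch)).
  + move=> s Ts; have [_ _ aB bB] := hT s Ts.
    rewrite normrM rmorphM /= ler_pM //.
      rewrite normrM normrX rmorphM rmorphXn /=.
      by rewrite ler_pM ?exprn_ge0 // lerXn2r // nnegrE -[0]/(0%:C) leCR.
    rewrite rmorphD rmorphM /= (le_trans (ler_normD _ _)) // lerD //.
    by rewrite normrM normr_nat rmorph_nat ler_wpM2l.
  + move=> s Ts; have [a0 b0 _ _] := hT s Ts.
    by rewrite /kernel3 /cauchy_kernel /remainder2; field; rewrite a0 b0.
- exact: continuous_along_cauchy_kernel.
- exact: (continuous_alongM (@continuous_along_cst _ g 2)
    (continuous_along_cauchy_kernel (k := 3%N) Tz)).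
Unshelve. all: by end_near. Qed.

End CauchyTransform.

(** * Entrywise contour integrals of matrix functions *)

Section MatrixContour.
Variables (R : realType) (g : R -> Cx R).
Local Notation C := (Cx R).

Lemma contour_integrable0 : contour_integrable g (fun=> 0).
Proof.
by split; apply: eq_integrable (integrable0 _ _) => // t _;
  rewrite /pullback mul0r.
Qed.

Lemma contour_integrable_sum (I : Type) (r : seq I) (f : I -> C -> C) :
  (forall i, contour_integrable g (f i)) ->
  contour_integrable g (fun s => \sum_(i <- r) f i s).
Proof.
move=> if_; elim: r => [|i r IHr].
  by apply: eq_contour_integrable contour_integrable0 => s _; rewrite big_nil.
apply: eq_contour_integrable (contour_integrableD (if_ i) IHr) => s _.
by rewrite big_cons.
Qed.

Lemma contour_int0 : contour_int g (fun=> 0) = 0.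
Proof.
rewrite -[RHS](mul0r (contour_int g (fun=> 0))).
rewrite -(contour_intZ 0 contour_integrable0).
by apply: eq_contour_int => s _; rewrite mul0r.
Qed.

Lemma contour_int_sum (I : Type) (r : seq I) (f : I -> C -> C) :
  (forall i, contour_integrable g (f i)) ->
  contour_int g (fun s => \sum_(i <- r) f i s) =
  \sum_(i <- r) contour_int g (f i).
Proof.
move=> if_; elim: r => [|i r IHr].
  rewrite big_nil -[RHS]contour_int0; apply: eq_contour_int => s _. by rewrite big_nil.
rewrite big_cons -IHr -contour_intD //; last exact: contour_integrable_sum.
by apply: eq_contour_int => s _; rewrite big_cons.
Qed.

Definition mx_integrable m n (F : C -> 'M[C]_(m, n)) :=
  forall i j, contour_integrable g (fun s => F s i j).

Lemma eq_mx_integrable m n (F G : C -> 'M[C]_(m, n)) :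
  (forall s, trace g s -> F s = G s) -> mx_integrable F -> mx_integrable G.
Proof. by move=> FG iF i j; apply: eq_contour_integrable (iF i j) => s /FG ->. Qed.

Lemma eq_contour_int_mx m n (F G : C -> 'M[C]_(m, n)) :
  (forall s, trace g s -> F s = G s) -> contour_int_mx g F = contour_int_mx g G.
Proof.
by move=> FG; apply/matrixP => i j; rewrite !mxE; apply: eq_contour_int => s /FG ->.
Qed.

Lemma mx_integrableM m n phi (F : C -> 'M[C]_(m, n)) : continuous_along g phi ->
  mx_integrable F -> mx_integrable (fun s => phi s *: F s).
Proof.
move=> cphi iF i j.
by apply: eq_contour_integrable (contour_integrableM cphi (iF i j)) => s _; rewrite mxE.
Qed.

Lemma contour_int_mxB m n (F G : C -> 'M[C]_(m, n)) :
  mx_integrable F -> mx_integrable G ->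
  contour_int_mx g (fun s => F s - G s) = contour_int_mx g F - contour_int_mx g G.
Proof.
move=> iF iG; apply/matrixP => i j; rewrite !mxE -[- contour_int _ _]mulN1r.
have iN := contour_integrableZ (-1) (iG i j).
rewrite -(contour_intZ _ (iG i j)) -(contour_intD (iF i j) iN).
by apply: eq_contour_int => s _; rewrite !mxE mulN1r.
Qed.

Lemma mx_integrable_sum (I : Type) (r : seq I) m n (F : I -> C -> 'M[C]_(m, n)) :
  (forall k, mx_integrable (F k)) ->
  mx_integrable (fun s => \sum_(k <- r) F k s).
Proof.
move=> iF i j.
apply: eq_contour_integrable (contour_integrable_sum r (fun k => iF k i j)) => s _.
by rewrite summxE.
Qed.

Lemma contour_int_mx_sum (I : Type) (r : seq I) m n (F : I -> C -> 'M[C]_(m, n)) :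
  (forall k, mx_integrable (F k)) ->
  contour_int_mx g (fun s => \sum_(k <- r) F k s) =
  \sum_(k <- r) contour_int_mx g (F k).
Proof.
move=> iF; apply/matrixP => i j; rewrite !mxE summxE.
under [RHS]eq_bigr do rewrite mxE.
rewrite -contour_int_sum; last by move=> k; exact: iF.
by apply: eq_contour_int => s _; rewrite summxE.
Qed.

Lemma mx_integrable_mull m n p (A : 'M[C]_(m, n)) (F : C -> 'M[C]_(n, p)) :
  mx_integrable F -> mx_integrable (fun s => A *m F s).
Proof.
move=> iF i j.
apply: eq_contour_integrable (contour_integrable_sum (index_enum _)
  (fun k => contour_integrableZ (A i k) (iF k j))) => s _.
by rewrite mxE.
Qed.

Lemma contour_int_mx_mull m n p (A : 'M[C]_(m, n)) (F : C -> 'M[C]_(n, p)) :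
  mx_integrable F ->
  contour_int_mx g (fun s => A *m F s) = A *m contour_int_mx g F.
Proof.
move=> iF; apply/matrixP => i j; rewrite !mxE.
under [RHS]eq_bigr do rewrite mxE -contour_intZ //.
rewrite -contour_int_sum; last by move=> k; exact: contour_integrableZ.
by apply: eq_contour_int => s _; rewrite mxE.
Qed.

Lemma mx_integrable_mulr m n p (A : 'M[C]_(n, p)) (F : C -> 'M[C]_(m, n)) :
  mx_integrable F -> mx_integrable (fun s => F s *m A).
Proof.
move=> iF i j.
apply: eq_contour_integrable (contour_integrable_sum (index_enum _)
  (fun k => contour_integrableZ (A k j) (iF i k))) => s _.
by rewrite mxE; apply: eq_bigr => k _; rewrite mulrC.
Qed.

Lemma contour_int_mx_mulr m n p (A : 'M[C]_(n, p)) (F : C -> 'M[C]_(m, n)) :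
  mx_integrable F ->
  contour_int_mx g (fun s => F s *m A) = contour_int_mx g F *m A.
Proof.
move=> iF; apply/matrixP => i j; rewrite !mxE.
under [RHS]eq_bigr do rewrite mxE mulrC -contour_intZ //.
rewrite -contour_int_sum; last by move=> k; exact: contour_integrableZ.
by apply: eq_contour_int => s _; rewrite mxE; apply: eq_bigr => k _; rewrite mulrC.
Qed.

End MatrixContour.

(** * Matrix polynomials at scalar points *)

Section ScalarHorner.
Variables (K : numFieldType) (N : nat).
Local Notation M := 'M[K]_N.+1.
Implicit Types p q : {poly M}.

Lemma horner_scalar_mx p n (s : K) : (size p <= n)%N ->
  p.[s%:M] = \sum_(k < n) s ^+ k *: p`_k.
Proof.
move=> pn; rewrite (horner_coef_wide _ pn); apply: eq_bigr => k _.
by rewrite -[s%:M]/(s%:M : M) -rmorphXn /= -mulmxE mul_mx_scalar.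
Qed.

Lemma is_derive_horner_scalar_mx p (z : K) :
  is_derive z 1 (fun w : K => p.[w%:M]) p^`().[z%:M].
Proof.
elim/poly_ind: p => [|p c IHp].
  rewrite linear0 horner0; under eq_fun do rewrite horner0.
  exact: is_derive_cst.
rewrite derivMXaddC hornerD hornerMX.
under eq_fun do rewrite hornerMXaddC -mulmxE mul_mx_scalar.
apply: is_derive_eq (is_deriveD (is_derive_scalemx (is_derive_id z 1) IHp)
  (is_derive_cst _ _ _)) _.
by rewrite scale1r addr0 -mulmxE mul_mx_scalar.
Qed.

(** The factor theorem holds over the noncommutative matrix ring, with X - z as right factor. The
    leading coefficient 1 in degree n - 1 is recorded because it is what orthogonality later picks
    out; for n = 0 the size bound forces q = 0. *)
Lemma monic_quotient p n (z : K) : p \is monic -> size p = n.+1 ->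
  exists q, [/\ forall s : K, p.[s%:M] - p.[z%:M] = (s - z) *: q.[s%:M],
    (size q <= n)%N & forall m, n = m.+1 -> q`_m = 1].
Proof.
move=> /monicP; rewrite lead_coefE => + pn; rewrite pn /= => pm.
have /factor_theorem[q qE] : root (p - (p.[z%:M])%:P) z%:M.
  by rewrite /root hornerD hornerN hornerC subrr.
have qn : (size q <= n)%N.
  have [->|q0] := eqVneq q 0; first by rewrite size_poly0.
  have : (size (q * ('X - (z%:M)%:P))%R <= n.+1)%N.
    rewrite -qE (leq_trans (size_polyD _ _)) // geq_max pn leqnn size_polyN.
    by rewrite (leq_trans (size_polyC_leq1 _)).
  by rewrite size_Mmonic ?monicXsubC // size_XsubC addn2.
exists q; split=> // [s|m nm].
  rewrite -[p.[z%:M]](hornerC _ s%:M) -hornerN -hornerD qE.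
  (* Evaluation respects this product because scalar matrices are central, so X - z commutes with
     the point of evaluation. *)
  rewrite hornerM_comm; last first.
    by apply: comm_polyD; [exact: comm_polyX|rewrite /comm_poly];
       rewrite hornerN hornerC mulrN mulNr -!mulmxE mul_scalar_mx mul_mx_scalar.
  rewrite hornerXsubC -(raddfB (@scalar_mx K N.+1)) /= -mulmxE mul_mx_scalar //.
(* Coefficients are compared in degree n = m + 1: the subtracted constant does not reach it, and the
   coefficient of [q] there is 0 by the size bound. *)
have := congr1 (fun r : {poly M} => r`_n) qE; rewrite coefB pm coefC nm /= subr0.
rewrite mulrBr coefB coefMX coefMC /= [q`_m.+1]nth_default -?nm // mul0r subr0.
by [].
Qed.

End ScalarHorner.

(** * Biorthogonality *)

(** Once [A] and [B] are replaced by difference quotients, the two products P W Q on the right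
    cancel. Read backwards, the kernel 1/d disappears from the left. *)
Lemma difference_quotient_mx (K : fieldType) n (d : K) (A B P Pz Q Qz W : 'M[K]_n) :
  d != 0 -> P - Pz = d *: A -> Q - Qz = d *: B ->
  Pz *m (d^-1 *: (W *m Q)) - d^-1 *: (P *m W) *m Qz =
  P *m W *m B - A *m W *m Q.
Proof.
move=> d0 PA QB.
have -> : A = d^-1 *: (P - Pz) by rewrite PA scalerA mulVf // scale1r.
have -> : B = d^-1 *: (Q - Qz) by rewrite QB scalerA mulVf // scale1r.
rewrite -!scalemxAr -!scalemxAl -!scalerBr; congr (_ *: _).
by rewrite mulmxBr !mulmxBl opprB [RHS]addrC addrA subrK !mulmxA.
Qed.

Section Biorthogonality.
Variables (R : realType) (N : nat) (g : R -> Cx R).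
Local Notation C := (Cx R).
Local Notation MC := 'M[C]_N.+1.
Variables (W : C -> MC) (PL PR : nat -> {poly MC}) (Cn : nat -> MC).
Hypothesis cg : {within `[0, 1], continuous g}.
Hypothesis iW : forall n, mx_integrable g (fun s => s ^+ n *: W s).
Hypothesis biorth : biorthogonal g W PL PR Cn.

Lemma mx_integrable_weight (p q : {poly MC}) :
  mx_integrable g (fun s => p.[s%:M] *m W s *m q.[s%:M]).
Proof.
apply: (@eq_mx_integrable _ _ _ _ (fun s => \sum_(i < size p) \sum_(j < size q)
    p`_i *m (s ^+ (i + j) *: W s) *m q`_j)) => [s _|].
  rewrite (horner_scalar_mx _ (leqnn (size p))) (horner_scalar_mx _ (leqnn (size q))).
  rewrite -mulmxA mulmx_suml; apply: eq_bigr => i _.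
  rewrite !mulmx_sumr; apply: eq_bigr => j _.
  by rewrite -!scalemxAl -!scalemxAr -!scalemxAl scalerA exprD mulmxA mulrC.
do 2 apply: mx_integrable_sum => ?.
exact: mx_integrable_mulr (mx_integrable_mull _ (iW _)).
Qed.

Lemma mx_integrable_weightl (p : {poly MC}) :
  mx_integrable g (fun s => p.[s%:M] *m W s).
Proof.
apply: eq_mx_integrable (mx_integrable_weight p 1) => s _.
by rewrite hornerC mulmx1.
Qed.

Lemma mx_integrable_weightr (q : {poly MC}) :
  mx_integrable g (fun s => W s *m q.[s%:M]).
Proof.
apply: eq_mx_integrable (mx_integrable_weight 1 q) => s _.
by rewrite hornerC mul1mx.
Qed.

Lemma continuous_along_id : continuous_along g id.
Proof. exact: cg. Qed.

(** The matrix coefficients of [q] stand to the right of the weight, so they leave the integral and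
    scalar powers remain, of which only s^n contributes. For smaller [q] the coefficient in degree n
    is 0, which covers plain orthogonality. *)
Lemma biorthL_poly n (q : {poly MC}) : (size q <= n.+1)%N ->
  contour_int_mx g (fun s => (PL n).[s%:M] *m W s *m q.[s%:M]) =
  invmx (Cn n) *m q`_n.
Proof.
move=> qn.
have iF (k : 'I_n.+1) : mx_integrable g (fun s => s ^+ k *: ((PL n).[s%:M] *m W s)).
  apply: (mx_integrableM (continuous_alongX (k := k) continuous_along_id)).
  exact: mx_integrable_weightl.
rewrite (@eq_contour_int_mx _ _ _ _ _ (fun s => \sum_(k < n.+1)
    (s ^+ k *: ((PL n).[s%:M] *m W s)) *m q`_k)) => [|s _]; last first.
  rewrite (horner_scalar_mx _ qn) mulmx_sumr; apply: eq_bigr => k _.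
  by rewrite -scalemxAl -scalemxAr.
rewrite contour_int_mx_sum => [|k]; last exact: mx_integrable_mulr.
rewrite big_ord_recr big1 /= => [|k _]; rewrite contour_int_mx_mulr.
- by rewrite add0r (biorthL biorth) // eqxx.
- exact: (iF ord_max).
- by rewrite (biorthL biorth) ?(ltnW (ltn_ord k)) // gtn_eqF // mul0mx.
- exact: (iF (widen_ord (leqnSn n) k)).
Qed.

Lemma biorthR_poly n (q : {poly MC}) : (size q <= n.+1)%N ->
  contour_int_mx g (fun s => q.[s%:M] *m W s *m (PR n).[s%:M]) =
  q`_n *m invmx (Cn n).
Proof.
move=> qn.
have iF (k : 'I_n.+1) : mx_integrable g (fun s => s ^+ k *: (W s *m (PR n).[s%:M])).
  apply: (mx_integrableM (continuous_alongX (k := k) continuous_along_id)).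
  exact: mx_integrable_weightr.
rewrite (@eq_contour_int_mx _ _ _ _ _ (fun s => \sum_(k < n.+1)
    q`_k *m (s ^+ k *: (W s *m (PR n).[s%:M])))) => [|s _]; last first.
  rewrite (horner_scalar_mx _ qn) -mulmxA mulmx_suml; apply: eq_bigr => k _.
  by rewrite -scalemxAl -scalemxAr.
rewrite contour_int_mx_sum => [|k]; last exact: mx_integrable_mull.
rewrite big_ord_recr big1 /= => [|k _]; rewrite contour_int_mx_mull.
- by rewrite add0r (biorthR biorth) // eqxx.
- exact: (iF ord_max).
- by rewrite (biorthR biorth) ?(ltnW (ltn_ord k)) // gtn_eqF // mulmx0.
- exact: (iF (widen_ord (leqnSn n) k)).
Qed.

(* Subtracting the values at z from both polynomials cancels the Cauchy kernel,
   and orthogonality then sees only two leading coefficients. *)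
Lemma casorati n m (z : C) (A B : {poly MC}) : ~ trace g z ->
  (forall s : C, (PL n).[s%:M] - (PL n).[z%:M] = (s - z) *: A.[s%:M]) ->
  (forall s : C, (PR m).[s%:M] - (PR m).[z%:M] = (s - z) *: B.[s%:M]) ->
  (size A <= m.+1)%N -> (size B <= n.+1)%N ->
  (PL n).[z%:M] *m QR g W PR m z - QL g W PL n z *m (PR m).[z%:M] =
  invmx (Cn n) *m B`_n - A`_m *m invmx (Cn m).
Proof.
move=> Tz PA PB sA sB; rewrite -(biorthL_poly sB) -(biorthR_poly sA).
have ck := continuous_along_inv cg Tz.
have iL := mx_integrableM ck (mx_integrable_weightl (PL n)).
have iR := mx_integrableM ck (mx_integrable_weightr (PR m)).
have -> : (PL n).[z%:M] *m QR g W PR m z - QL g W PL n z *m (PR m).[z%:M] =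
    contour_int_mx g (fun s => (PL n).[z%:M] *m ((s - z)^-1 *: (W s *m (PR m).[s%:M]))
      - (s - z)^-1 *: ((PL n).[s%:M] *m W s) *m (PR m).[z%:M]).
  rewrite (contour_int_mxB (mx_integrable_mull _ iR) (mx_integrable_mulr _ iL)).
  by rewrite (contour_int_mx_mull _ iR) (contour_int_mx_mulr _ iL).
rewrite -(contour_int_mxB (mx_integrable_weight (PL n) B) (mx_integrable_weight A (PR m))).
apply: eq_contour_int_mx => s Ts.
have sz : s - z != 0 by rewrite subr_eq0; apply: contra_notN Tz => /eqP <-.
exact: difference_quotient_mx sz (PA s) (PB s).
Qed.

End Biorthogonality.

(** * Block identities for J *)

Section Symplectic.
Variables (K : fieldType) (m : nat).
Implicit Types P Q p q C : 'M[K]_m.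

Definition symplectic_mx : 'M[K]_(m + m) := block_mx 0 1%:M (- 1%:M) 0.
Local Notation J := symplectic_mx.

Lemma symplectic_unit : J *m (- J) = 1%:M.
Proof.
rewrite mulmxN mulmx_block !(mul0mx, mulmx0, mul1mx, mulmx1, add0r, addr0).
by rewrite opp_block_mx !oppr0 opprK -scalar_mx_block.
Qed.

Lemma block_mx_symplectic0 P Q P' Q' :
  P = 1%:M -> P' = 1%:M -> P *m Q' - Q *m P' = 0 ->
  block_mx P Q 0 1%:M *m J *m block_mx P' 0 Q' 1%:M = J.
Proof.
move=> -> ->; rewrite mul1mx mulmx1 => /eqP; rewrite subr_eq0 => /eqP ->.
rewrite !mulmx_block !(mul0mx, mulmx0, mul1mx, mulmx1, add0r, addr0, mulmxN).
by rewrite addNr.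
Qed.

(** Capitals stand for index n, small letters for n - 1, primes for the right-hand family. The four
    blocks are Casorati combinations; the factors [C] in the lower row and the right column turn the
    two nonzero ones, which are C^-1 up to sign, into identity matrices. *)
Lemma block_mx_symplectic P Q p q P' Q' p' q' C : C \in unitmx ->
  P *m Q' - Q *m P' = 0 -> P *m q' - Q *m p' = - invmx C ->
  p *m Q' - q *m P' = invmx C -> p *m q' - q *m p' = 0 ->
  block_mx P Q (- (C *m p)) (- (C *m q)) *m J *m
    block_mx P' (- (p' *m C)) Q' (- (q' *m C)) = J.
Proof.
move=> Cu D11 D12 D21 D22.
rewrite !mulmx_block !(mulmx0, mulmx1, add0r, addr0, mulmxN, mulNmx) !opprK.
congr block_mx.
- by rewrite addrC D11.
- rewrite !mulmxA -mulmxBl.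
  have -> : Q *m p' - P *m q' = invmx C by rewrite -opprB D12 opprK.
  by rewrite mulVmx.
- rewrite -!mulmxA -mulmxBr.
  have -> : q *m P' - p *m Q' = - invmx C by rewrite -opprB D21.
  by rewrite mulmxN mulmxV.
- by rewrite !mulmxA addrC -mulmxBl -!mulmxA -mulmxBr D22 mulmx0 mul0mx.
Qed.

End Symplectic.

(** * Invertibility and smoothness of Y off the curve *)

Section FundamentalMatrix.
Variables (R : realType) (N : nat) (g : R -> Cx R).
Local Notation C := (Cx R).
Local Notation MC := 'M[C]_N.+1.
Variables (W : C -> MC) (PL PR : nat -> {poly MC}) (Cn : nat -> MC).
Hypothesis cg : {within `[0, 1], continuous g}.
Hypothesis iW : forall n, mx_integrable g (fun s => s ^+ n *: W s).
Hypothesis biorth : biorthogonal g W PL PR Cn.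

(** The quotient of a polynomial of degree n has size at most n, so n <= m + 1 brings it within
    reach of the orthogonality of P_m^R, and symmetrically. Its coefficient in degree m is 1 when n
    = m + 1 and 0 otherwise. *)
Let casoratiE n m (z : C) : ~ trace g z -> (n <= m.+1)%N -> (m <= n.+1)%N ->
  (PL n).[z%:M] *m QR g W PR m z - QL g W PL n z *m (PR m).[z%:M] =
  (if m == n.+1 then invmx (Cn n) else 0) - (if n == m.+1 then invmx (Cn m) else 0).
Proof.
move=> Tz nm mn; have [mL sL] := biorthL_monic biorth n.
have [mR sR] := biorthR_monic biorth m.
have [A [PA sA A1]] := monic_quotient z mL sL.
have [B [PB sB B1]] := monic_quotient z mR sR.
rewrite (casorati cg iW biorth Tz PA PB (leq_trans sA nm) (leq_trans sB mn)).
congr (_ - _).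
  case: eqP => [/B1 ->|/eqP mn']; first by rewrite mulmx1.
  by rewrite nth_default ?mulmx0 // (leq_trans sB) // -ltnS ltn_neqAle mn'.
case: eqP => [/A1 ->|/eqP nm']; first by rewrite mul1mx.
by rewrite nth_default ?mul0mx // (leq_trans sA) // -ltnS ltn_neqAle nm'.
Qed.

Let J : 'M[C]_(N.+1 + N.+1) := symplectic_mx _ _.

Lemma YL_J_YR n (z : C) : ~ trace g z ->
  YL g W PL Cn n z *m J *m YR g W PR Cn n z = J.
Proof.
move=> Tz; case: n => [|n].
  have D00 := @casoratiE 0 0 z Tz isT isT.
  have [mL sL] := biorthL_monic biorth 0%N.
  have [mR sR] := biorthR_monic biorth 0%N.
  have P1 (p : {poly MC}) : p \is monic -> size p = 1%N -> p.[z%:M] = 1%:M.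
    move=> /monicP; rewrite lead_coefE => + sp; rewrite sp [p]size1_polyC ?sp //.
    by rewrite coefC hornerC /= => ->.
  apply: block_mx_symplectic0; [exact: P1|exact: P1|].
  by move: D00; rewrite subr0.
have neq k : (k == k.+1) = false by apply/eqP; exact/n_Sn.
have neq2 k : (k == k.+2) = false by elim: k.
apply: block_mx_symplectic (biorth_unit biorth n) _ _ _ _.
- by have := casoratiE Tz (leqnSn n.+1) (leqnSn n.+1); rewrite neq subr0.
- have := casoratiE Tz (leqnn n.+1) (leq_trans (leqnSn n) (leqnSn n.+1)).
  by rewrite eqxx neq2 sub0r.
- have := casoratiE Tz (leq_trans (leqnSn n) (leqnSn n.+1)) (leqnn n.+1).
  by rewrite eqxx neq2 subr0.
- by have := casoratiE Tz (leqnSn n) (leqnSn n); rewrite neq subr0.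
Qed.

(** A one-sided inverse of a square matrix suffices: since - J inverts J, the single identity
    exhibits one for each of the two matrices. *)
Lemma YL_YR_unit n (z : C) : ~ trace g z ->
  YL g W PL Cn n z \in unitmx /\ YR g W PR Cn n z \in unitmx.
Proof.
move=> Tz; have JJ : J *m (- J) = 1%:M by exact: symplectic_unit.
have EL : (YL g W PL Cn n z *m J) *m (YR g W PR Cn n z *m - J) = 1%:M.
  by rewrite mulmxA YL_J_YR.
have ER : (- J *m (YL g W PL Cn n z *m J)) *m YR g W PR Cn n z = 1%:M.
  by rewrite -mulmxA YL_J_YR // mulNmx -mulmxN.
have [YLu _] := mulmx1_unit EL; have [_ YRu] := mulmx1_unit ER.
by move: YLu; rewrite unitmx_mul => /andP[].
Qed.

(** The first derivative is exhibited as one function on the whole complement of the curve, because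
    the product rule for Y D is used at all points near z before differentiating again. *)
Definition twice_derivable m n (F : C -> 'M[C]_(m, n)) := exists F1 : C -> 'M[C]_(m, n),
  forall w : C, ~ trace g w -> is_derive w 1 F (F1 w) /\ derivable F1 w 1.

Lemma twice_derivable_cst m n (A : 'M[C]_(m, n)) : twice_derivable (fun=> A).
Proof.
exists (fun=> 0) => w _; split; first exact: is_derive_cst.
exact: derivable_cst.
Qed.

Lemma twice_derivable_horner (p : {poly MC}) : twice_derivable (fun w => p.[w%:M]).
Proof.
exists (fun w => p^`().[w%:M]) => w _; split; first exact: is_derive_horner_scalar_mx.
by have [] := is_derive_horner_scalar_mx p^`() w.
Qed.

Lemma twice_derivableN m n (F : C -> 'M[C]_(m, n)) :
  twice_derivable F -> twice_derivable (fun w => - F w).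
Proof.
move=> [F1 dF]; exists (fun w => - F1 w) => w /dF[dFw dF1w].
by split; [exact: is_deriveN|exact: derivableN].
Qed.

Lemma twice_derivable_mull m n p (A : 'M[C]_(m, n)) (F : C -> 'M[C]_(n, p)) :
  twice_derivable F -> twice_derivable (fun w => A *m F w).
Proof.
have dA (w : C) : is_derive w 1 (fun=> A) 0 by exact: is_derive_cst.
move=> [F1 dF]; exists (fun w => A *m F1 w) => w /dF[dFw dF1w]; split.
  by have := is_derive_mulmx (dA w) dFw; rewrite mul0mx add0r.
by have [] := is_derive_mulmx (dA w) (derivable_is_derive1 dF1w).
Qed.

Lemma twice_derivable_mulr m n p (A : 'M[C]_(n, p)) (F : C -> 'M[C]_(m, n)) :
  twice_derivable F -> twice_derivable (fun w => F w *m A).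
Proof.
have dA (w : C) : is_derive w 1 (fun=> A) 0 by exact: is_derive_cst.
move=> [F1 dF]; exists (fun w => F1 w *m A) => w /dF[dFw dF1w]; split.
  by have := is_derive_mulmx dFw (dA w); rewrite mulmx0 addr0.
by have [] := is_derive_mulmx (derivable_is_derive1 dF1w) (dA w).
Qed.

Lemma twice_derivable_block m1 m2 n1 n2 (F : C -> 'M[C]_(m1, n1))
    (G : C -> 'M[C]_(m1, n2)) (H : C -> 'M[C]_(m2, n1)) (K : C -> 'M[C]_(m2, n2)) :
  twice_derivable F -> twice_derivable G -> twice_derivable H -> twice_derivable K ->
  twice_derivable (fun w => block_mx (F w) (G w) (H w) (K w)).
Proof.
move=> [F1 dF] [G1 dG] [H1 dH] [K1 dK].
exists (fun w => block_mx (F1 w) (G1 w) (H1 w) (K1 w)) => w Tw.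
have [[dFw dF1] [dGw dG1]] := (dF w Tw, dG w Tw).
have [[dHw dH1] [dKw dK1]] := (dH w Tw, dK w Tw).
split; first exact: is_derive_block_mx.
by have [] := is_derive_block_mx (derivable_is_derive1 dF1)
  (derivable_is_derive1 dG1) (derivable_is_derive1 dH1) (derivable_is_derive1 dK1).
Qed.

Lemma twice_derivable_cauchy m n (F : C -> 'M[C]_(m, n)) : mx_integrable g F ->
  twice_derivable (fun w => contour_int_mx g (fun s => (s - w)^-1 *: F s)).
Proof.
move=> iF; exists (fun w => \matrix_(i, j) cauchy_int g 2 (fun s => F s i j) w) => w Tw.
have entry i j : (fun u => contour_int_mx g (fun s => (s - u)^-1 *: F s) i j) =
    cauchy_int g 1 (fun s => F s i j).
  by apply/funext => u; rewrite mxE; apply: eq_contour_int => s _; rewrite mxE.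
split; first by apply/is_derive_mxP => i j; rewrite mxE entry; exact: is_derive_cauchy1.
pose F2 : 'M[C]_(m, n) := \matrix_(i, j) derive1 (cauchy_int g 2 (fun s => F s i j)) w.
suff [] : is_derive w 1 (fun u => \matrix_(i, j) cauchy_int g 2 (fun s => F s i j) u) F2.
  by [].
apply/is_derive_mxP => i j; under eq_fun do rewrite mxE; rewrite mxE.
have [dij _] := is_derive_cauchy2 cg (iF i j) Tw.
exact: derivable_is_derive1 dij.
Qed.

Lemma twice_derivable_YL n : twice_derivable (YL g W PL Cn n).
Proof.
have dP k := twice_derivable_horner (PL k).
have dQ k := twice_derivable_cauchy (mx_integrable_weightl iW (PL k)).
case: n => [|n].
  exact: twice_derivable_block (dP 0%N) (dQ 0%N) (twice_derivable_cst 0)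
    (twice_derivable_cst 1%:M).
exact: twice_derivable_block (dP n.+1) (dQ n.+1)
  (twice_derivableN (twice_derivable_mull (Cn n) (dP n)))
  (twice_derivableN (twice_derivable_mull (Cn n) (dQ n))).
Qed.

Lemma twice_derivable_YR n : twice_derivable (YR g W PR Cn n).
Proof.
have dP k := twice_derivable_horner (PR k).
have dQ k := twice_derivable_cauchy (mx_integrable_weightr iW (PR k)).
case: n => [|n].
  exact: twice_derivable_block (dP 0%N) (twice_derivable_cst 0) (dQ 0%N)
    (twice_derivable_cst 1%:M).
exact: twice_derivable_block (dP n.+1)
  (twice_derivableN (twice_derivable_mulr (Cn n) (dP n))) (dQ n.+1)
  (twice_derivableN (twice_derivable_mulr (Cn n) (dQ n))).
Qed.

End FundamentalMatrix.

(** * The differential equations *)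

Section SecondOrder.
Variables (R : realType) (N : nat) (g : R -> Cx R) (cut : set (Cx R)).
Variables (W WL WR hL hR : Cx R -> 'M[Cx R]_N.+1).
Variables (PL PR : nat -> {poly 'M[Cx R]_N.+1}) (Cn : nat -> 'M[Cx R]_N.+1).
Local Notation C := (Cx R).
Hypothesis loop_g : bessel_loop g.
Hypothesis regular_W : regular g W.
Hypothesis factor_W : factorization g cut W WL WR hL hR.
Hypothesis biorth : biorthogonal g W PL PR Cn.

Let cg : {within `[0, 1], continuous g} := loop_continuous loop_g.
Let iW : forall n, mx_integrable g (fun s => s ^+ n *: W s) := regular_W.1.
Let off (w : C) := ~ (trace g w \/ cut w).

Let off_trace w : off w -> ~ trace g w.
Proof. by move=> ow Tw; apply: ow; left. Qed.

Let near_off (w : C) : off w -> \forall u \near w, off u.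
Proof.
move=> ow; apply: open_nbhs_nbhs; split => //.
apply: (@closed_openC _ (trace g `|` cut)); apply: closedU.
  exact: trace_closed.
exact: cut_closed factor_W.
Qed.

Let off_neq0 (w : C) : off w -> w != 0.
Proof.
move=> ow; apply/eqP => w0; apply: (off_trace ow); exists 0.
  by rewrite /= in_itv /= lexx ler01.
by rewrite w0; exact: loop_start.
Qed.

Let dWL (w : C) : off w -> is_derive w 1 WL (w ^- 2 *: (hL w *m WL w)).
Proof.
move=> ow; have w0 := off_neq0 ow.
rewrite -(factorL_ode factor_W ow) scalerA mulVf ?expf_neq0 // scale1r.
exact/derivable_is_derive1/(factorL_holo factor_W ow).
Qed.

Let dWR (w : C) : off w -> is_derive w 1 WR (w ^- 2 *: (WR w *m hR w)).
Proof.
move=> ow; have w0 := off_neq0 ow.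
rewrite -(factorR_ode factor_W ow) scalerA mulVf ?expf_neq0 // scale1r.
exact/derivable_is_derive1/(factorR_holo factor_W ow).
Qed.

(** Inversion moves the coefficient to the other side and changes its sign. This is how - h^L and -
    h^R come to sit in the second diagonal blocks. *)
Let dWLV (w : C) : off w ->
  is_derive w 1 (fun u => invmx (WL u)) (w ^- 2 *: (invmx (WL w) *m - hL w)).
Proof.
move=> ow; have WLu : \forall u \near w, WL u \in unitmx.
  by apply: filterS (near_off ow) => u /(factorL_unit factor_W).
have := is_derive_invmx WLu (dWL ow).
by rewrite -scalemxAr -scalemxAl mulmxA mulmxK ?(nbhs_singleton WLu) // -scalerN mulmxN.
Qed.

Let dWRV (w : C) : off w ->
  is_derive w 1 (fun u => invmx (WR u)) (w ^- 2 *: (- hR w *m invmx (WR w))).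
Proof.
move=> ow; have WRu : \forall u \near w, WR u \in unitmx.
  by apply: filterS (near_off ow) => u /(factorR_unit factor_W).
have := is_derive_invmx WRu (dWR ow).
by rewrite -scalemxAr -scalemxAl mulKmx ?(nbhs_singleton WRu) // -scalerN mulNmx.
Qed.

Let diag_unit (A B : 'M[C]_N.+1) : A \in unitmx -> B \in unitmx ->
  block_mx A 0 0 (invmx B) \in unitmx.
Proof.
move=> Au Bu; rewrite unitmxE det_ublock unitrM -!unitmxE unitmx_inv.
by rewrite Au Bu.
Qed.

Let block_mxD_scalar (A B : 'M[C]_N.+1) (z : C) :
  2 *: block_mx A 0 0 (- B) + (2 * z)%:M =
  block_mx (2 *: A + (2 * z)%:M) 0 0 (- (2 *: B) + (2 * z)%:M).
Proof.
by rewrite scale_block_mx !scaler0 scalerN scalar_mx_block add_block_mx !addr0.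
Qed.

Let calB_block (h k : C -> 'M[C]_N.+1) (z : C) dh dk :
  is_derive z 1 h dh -> is_derive z 1 (fun w => - k w) (- dk) ->
  block_mx dh 0 0 (- dk)
    + z ^- 2 *: (block_mx (h z) 0 0 (- k z) *m block_mx (h z) 0 0 (- k z))
  = block_mx (calB h z) 0 0 (calB (fun w => - k w) z).
Proof.
move=> hh hk; rewrite mulmx_block !mulmx0 !mul0mx !addr0 !add0r scale_block_mx.
rewrite !scaler0 add_block_mx !addr0 /calB.
by rewrite !(is_derive_derive1 hh, is_derive_derive1 hk).
Qed.

Let d0 (w : C) : is_derive w 1 (fun=> 0 : 'M[C]_N.+1) 0.
Proof. exact: is_derive_cst. Qed.

Lemma YL_second_order n (z : C) : off z ->
  z ^+ 2 *: derive1n 2 (YL g W PL Cn n) z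
  + derive1 (YL g W PL Cn n) z *m
      block_mx (2 *: hL z + (2 * z)%:M) 0 0 (- (2 *: hR z) + (2 * z)%:M)
  + YL g W PL Cn n z *m
      block_mx (calB hL z) 0 0 (calB (fun w => - hR w) z)
  = calB (MtL g W PL Cn WL WR n) z *m YL g W PL Cn n z.
Proof.
move=> oz; have [Y1 dY] := twice_derivable_YL PL Cn cg iW n.
have [dYz dY1] := dY z (off_trace oz).
have dhL := derivable_is_derive1 (hL_entire factor_W (z := z) I).
have dhR := is_deriveN (derivable_is_derive1 (hR_entire factor_W (z := z) I)).
pose H w := block_mx (hL w) 0 0 (- hR w).
pose D w := block_mx (WL w) 0 0 (invmx (WR w)).
have nearz : \forall w \near z,
    [/\ YL g W PL Cn n w \in unitmx, D w \in unitmx,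
      is_derive (w : C) 1 (YL g W PL Cn n) (Y1 w)
    & is_derive (w : C) 1 D (w ^- 2 *: (H w *m D w))].
  apply: filterS (near_off oz) => w ow; have Tw := off_trace ow; split.
  - exact: (YL_YR_unit cg iW biorth n Tw).1.
  - exact: diag_unit (factorL_unit factor_W ow) (factorR_unit factor_W ow).
  - exact: (dY w Tw).1.
  - rewrite mulmx_block !mulmx0 !mul0mx !addr0 !add0r scale_block_mx !scaler0.
    exact: is_derive_block_mx (dWL ow) (d0 w) (d0 w) (dWRV ow).
have nearY : \forall w \near z, is_derive (w : C) 1 (YL g W PL Cn n) (Y1 w).
  by apply: filterS nearz => w [].
have dH := is_derive_block_mx dhL (d0 z) (d0 z) dhR.
have [_] := structure_matrixL (off_neq0 oz) nearz (derivable_is_derive1 dY1) dH.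
(* The derivative [Y1] supplied by smoothness is traded for [derive1] and [derive1n 2] of Y
   itself. *)
rewrite -(derive1n2E nearY (derivable_is_derive1 dY1)) -(is_derive_derive1 dYz).
by rewrite block_mxD_scalar (calB_block dhL dhR).
Qed.

Lemma YR_second_order n (z : C) : off z ->
  z ^+ 2 *: derive1n 2 (YR g W PR Cn n) z
  + block_mx (2 *: hR z + (2 * z)%:M) 0 0 (- (2 *: hL z) + (2 * z)%:M) *m
      derive1 (YR g W PR Cn n) z
  + block_mx (calB hR z) 0 0 (calB (fun w => - hL w) z) *m
      YR g W PR Cn n z
  = YR g W PR Cn n z *m calB (MtR g W PR Cn WL WR n) z.
Proof.
move=> oz; have [Y1 dY] := twice_derivable_YR PR Cn cg iW n.
have [dYz dY1] := dY z (off_trace oz).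
have dhR := derivable_is_derive1 (hR_entire factor_W (z := z) I).
have dhL := is_deriveN (derivable_is_derive1 (hL_entire factor_W (z := z) I)).
pose H w := block_mx (hR w) 0 0 (- hL w).
pose D w := block_mx (WR w) 0 0 (invmx (WL w)).
have nearz : \forall w \near z,
    [/\ YR g W PR Cn n w \in unitmx, D w \in unitmx,
      is_derive (w : C) 1 (YR g W PR Cn n) (Y1 w)
    & is_derive (w : C) 1 D (w ^- 2 *: (D w *m H w))].
  apply: filterS (near_off oz) => w ow; have Tw := off_trace ow; split.
  - exact: (YL_YR_unit cg iW biorth n Tw).2.
  - exact: diag_unit (factorR_unit factor_W ow) (factorL_unit factor_W ow).
  - exact: (dY w Tw).1.
  - rewrite mulmx_block !mulmx0 !mul0mx !addr0 !add0r scale_block_mx !scaler0.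
    exact: is_derive_block_mx (dWR ow) (d0 w) (d0 w) (dWLV ow).
have nearY : \forall w \near z, is_derive (w : C) 1 (YR g W PR Cn n) (Y1 w).
  by apply: filterS nearz => w [].
have dH := is_derive_block_mx dhR (d0 z) (d0 z) dhL.
have := structure_matrixR (off_neq0 oz) nearz (derivable_is_derive1 dY1) dH.
rewrite -(derive1n2E nearY (derivable_is_derive1 dY1)) -(is_derive_derive1 dYz).
by rewrite block_mxD_scalar (calB_block dhR dhL).
Qed.

End SecondOrder.

Theorem proposition2 (R : realType) (N : nat) (g : R -> Cx R) (cut : set (Cx R))
    (W WL WR hL hR : Cx R -> 'M[Cx R]_N.+1)
    (PL PR : nat -> {poly 'M[Cx R]_N.+1}) (Cn : nat -> 'M[Cx R]_N.+1)
    (loop_g : bessel_loop g)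
    (bessel_W : bessel_type g W)
    (regular_W : regular g W)
    (factor_W : factorization g cut W WL WR hL hR)
    (biorth : biorthogonal g W PL PR Cn)
    (n : nat) (z : Cx R) (z_off : ~ (trace g z \/ cut z)) :
  z ^+ 2 *: derive1n 2 (YL g W PL Cn n) z
  + derive1 (YL g W PL Cn n) z *m
      block_mx (2 *: hL z + (2 * z)%:M) 0 0 (- (2 *: hR z) + (2 * z)%:M)
  + YL g W PL Cn n z *m
      block_mx (calB hL z) 0 0 (calB (fun w => - hR w) z)
  = calB (MtL g W PL Cn WL WR n) z *m YL g W PL Cn n z
  /\
  z ^+ 2 *: derive1n 2 (YR g W PR Cn n) z
  + block_mx (2 *: hR z + (2 * z)%:M) 0 0 (- (2 *: hL z) + (2 * z)%:M) *m
      derive1 (YR g W PR Cn n) z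
  + block_mx (calB hR z) 0 0 (calB (fun w => - hL w) z) *m
      YR g W PR Cn n z
  = YR g W PR Cn n z *m calB (MtR g W PR Cn WL WR n) z.
Proof.
split; first exact: YL_second_order loop_g regular_W factor_W biorth n z z_off.
exact: YR_second_order loop_g regular_W factor_W biorth n z z_off.
Qed.
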